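(* Let $D=(\mathbf{X}_1,\dots,\mathbf{X}_T,\mathbf{Y})$ be a random dataset of $m$ independent samples from the Gaussian-linear system $$X_t = A_{t-1}^\top X_{t-1}+\epsilon_t\ (t=2,\dots,T),\qquad Y=\beta^\top X_T+\epsilon_Y,$$ with isotropic noise $\epsilon_t\sim\mathcal{N}(0,\sigma_t^2 I)$, $\epsilon_Y\sim\mathcal{N}(0,\sigma_Y^2)$, and arbitrary distribution of $X_1$. Let $\theta=A_1\cdots A_{T-1}\beta$, $\hat\theta_{\mathrm{OLS}}=(\mathbf{X}_1^\top\mathbf{X}_1)^{-1}\mathbf{X}_1^\top\mathbf{Y}$, and $\hat\theta_{\mathrm{LuPTS}}=\hat A_1\cdots\hat A_{T-1}\hat\beta$ (the non-stationary LuPTS estimator). Then $\hat\theta_{\mathrm{LuPTS}}$ is unbiased, i.e. $\mathbb{E}_D[\hat\theta_{\mathrm{LuPTS}}]=\theta$, and $$\mathrm{MSE}(\hat\theta_{\mathrm{LuPTS}})=\mathrm{MSE}(\hat\theta_{\mathrm{OLS}})-\mathbb{E}_D\big[\mathrm{Var}(\hat\theta_{\mathrm{OLS}}\mid\hat\theta_{\mathrm{LuPTS}})\big],$$ where $\mathrm{Var}(\cdot\mid\cdot)$ of a vector is the sum of the element-wise conditional variances. Further, $$\overline{R}(\hat\theta_{\mathrm{LuPTS}})=\overline{R}(\hat\theta_{\mathrm{OLS}})-\mathbb{E}_{D,X_1}\big[\mathrm{Var}_{\hat\theta_{\mathrm{OLS}}}(\hat\theta_{\mathrm{OLS}}^\top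 X_1\mid\hat\theta_{\mathrm{LuPTS}})\big],$$ where $X_1$ is a new test point independent of $D$ and the conditional variance is over $\hat\theta_{\mathrm{OLS}}$ with $X_1$ held fixed. Consequently $\mathrm{MSE}(\hat\theta_{\mathrm{LuPTS}})\le\mathrm{MSE}(\hat\theta_{\mathrm{OLS}})$ and $\overline{R}(\hat\theta_{\mathrm{LuPTS}})\le\overline{R}(\hat\theta_{\mathrm{OLS}})$.
   Context: $X_t\in\mathbb{R}^d$ for $t=1,\dots,T$, $Y\in\mathbb{R}$; $A_1,\dots,A_{T-1}\in\mathbb{R}^{d\times d}$ and $\beta\in\mathbb{R}^d$ are fixed unknown parameters. The noise variables $\epsilon_2,\dots,\epsilon_T,\epsilon_Y$ are mutually independent and independent of $X_1$ (so $X_1,\dots,X_T,Y$ is a Markov chain). No assumption is made on the form of the distribution of $X_1$. Data: $(x_{i,1},\dots,x_{i,T},y_i)$, $i=1,\dots,m$, are i.i.d. copies of $(X_1,\dots,X_T,Y)$; $\mathbf{X}_t\in\mathbb{R}^{m\times d}$ is the matrix whose $i$-th row is $x_{i,t}^\top$, and $\mathbf{Y}=(y_1,\dots,y_m)^\top$. Non-stationary LuPTS estimator: $\hat A_t=\arg\min_{A\in\mathbb{R}^{d\times d}}\frac1m\sum_{i=1}^m\|A^\top x_{i,t}-x_{i,t+1}\|_2^2=(\mathbf{X}_t^\top\mathbf{X}_t)^{-1}\mathbf{X}_t^\top\mathbf{X}_{t+1}$ for $t=1,\dots,T-1$; $\hat\beta=\arg\min_{b\in\mathbb{R}^d}\frac1m\sum_{i=1}^m(b^\top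 x_{i,T}-y_i)^2=(\mathbf{X}_T^\top\mathbf{X}_T)^{-1}\mathbf{X}_T^\top\mathbf{Y}$; output $\hat\theta_{\mathrm{LuPTS}}=\hat A_1\cdots\hat A_{T-1}\hat\beta$. For an estimator $\hat\theta$ that is a function of $D$: $\mathrm{MSE}(\hat\theta)=\mathbb{E}_D[\|\hat\theta-\theta\|_2^2]$ and $\overline{R}(\hat\theta)=\mathbb{E}_D[\mathbb{E}_{X_1,Y}[(\hat\theta^\top X_1-Y)^2]]$, where $(X_1,Y)$ is a fresh draw from the system independent of $D$. Conventions: the matrices $\mathbf{X}_t^\top\mathbf{X}_t$ ($t=1,\dots,T$) are almost surely invertible, so all estimators are well defined, and the expectations appearing (in particular the MSE and $\overline R$ of $\hat\theta_{\mathrm{OLS}}$) are finite. *)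

(* Defs.v *)
From HB Require Import structures.
From mathcomp Require Import all_boot all_order all_algebra.
From mathcomp Require Import all_classical all_reals all_analysis.

Set Implicit Arguments.
Unset Strict Implicit.
Unset Printing Implicit Defensive.
Import Order.TTheory GRing.Theory Num.Theory.
Import numFieldNormedType.Exports.
Local Open Scope classical_set_scope.
Local Open Scope ring_scope.

(* Real matrices carry the sigma-algebra generated by the entries, i.e. the
   Borel sigma-algebra of R^(m x n). *)
Fact measure_matrix_display : measure_display.
Proof. exact: default_measure_display. Qed.

Definition matrix_measurable (R : realType) (m n : nat) :
    set (set 'M[R]_(m, n)) :=
  <<s \bigcup_(ij : 'I_m * 'I_n)
        preimage_set_system setT (fun M : 'M[R]_(m, n) => M ij.1 ij.2)
          (@measurable _ R) >>.

Section matrix_measurableType.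
Variables (R : realType) (m n : nat).

Let matrix_set0 : @matrix_measurable R m n set0.
Proof. exact: sigma_algebra0. Qed.

Let matrix_setC A :
  @matrix_measurable R m n A -> @matrix_measurable R m n (~` A).
Proof. exact: sigma_algebraC. Qed.

Let matrix_bigcup (F : _^nat) : (forall i, @matrix_measurable R m n (F i)) ->
  @matrix_measurable R m n (\bigcup_i F i).
Proof. exact: sigma_algebra_bigcup. Qed.

HB.instance Definition _ := @isMeasurable.Build measure_matrix_display
  'M[R]_(m, n) (@matrix_measurable R m n) matrix_set0 matrix_setC matrix_bigcup.

End matrix_measurableType.

Section probability.
Context {dO : measure_display} {Omega : measurableType dO} {R : realType}.
Variable P : probability Omega R.

Definition mutual_indep (I : finType) (G : I -> set (set Omega)) : Prop :=
  forall (J : {set I}) (E : I -> set Omega),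
    (forall i, i \in J -> G i (E i)) ->
    P (\bigcap_(i in [set` J]) E i) = (\prod_(i in J) P (E i))%E.

(* The library's [normal_prob m 0] is uniform on [0, 1]; the degenerate normal
   law N(m, 0) is the point mass at m. *)
Definition gaussian_law (m s : R) (B : set R) : \bar R :=
  if s == 0 then \d_m B else normal_prob m s B.

(* e has law N(0, s^2 I). *)
Definition isotropic_gaussian (d : nat) (s : R) (e : Omega -> 'cV[R]_d) : Prop :=
  (forall (j : 'I_d) (B : set R), measurable B ->
     pushforward P (fun w => e w j 0) B = gaussian_law 0 s B) /\
  mutual_indep (fun j : 'I_d => g_sigma_algebra_preimage (fun w => e w j 0)).

Context {dL : measure_display} {T : measurableType dL}.
Variable L : Omega -> T.

(* g is a version of E[f | L]. *)
Definition is_cond_exp (f g : Omega -> R) : Prop :=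
  [/\ forall B : set R, measurable B -> g_sigma_algebra_preimage L (g @^-1` B),
      P.-integrable [set: Omega] (EFin \o g) &
      forall A, g_sigma_algebra_preimage L A ->
        (\int[P]_(w in A) (g w)%:E = \int[P]_(w in A) (f w)%:E)%E].

(* Meaningful for integrable f, for which a version exists and is unique up to
   a null set; the zero function if there is no version. *)
Definition cond_exp (f : Omega -> R) : Omega -> R :=
  xget (cst 0) [set g | is_cond_exp f g].

Definition cond_var (f : Omega -> R) : Omega -> R :=
  cond_exp (fun w => (f w - cond_exp f w) ^+ 2).

Definition cond_var_vec (d : nat) (v : Omega -> 'cV[R]_d) : Omega -> R :=
  fun w => \sum_(j < d) cond_var (fun w' => v w' j 0) w.

End probability.

Section estimators.
Variable R : realType.

Definition dotv (d : nat) (u v : 'cV[R]_d) : R := \sum_(j < d) u j 0 * v j 0.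

(* Euclidean norm: `|v| is the sup norm on matrices. *)
Definition sqnorm2 (d : nat) (v : 'cV[R]_d) : R := dotv v v.

Definition least_squares (m d k : nat) (X : 'M[R]_(m, d)) (Y : 'M[R]_(m, k)) :
    'M[R]_(d, k) :=
  invmx (X^T *m X) *m X^T *m Y.

Definition sqerr (m d k : nat) (X : 'M[R]_(m, d)) (Y : 'M[R]_(m, k))
    (B : 'M[R]_(d, k)) : R :=
  \sum_(i < m) \sum_(j < k) (X *m B - Y) i j ^+ 2.

Lemma least_squares_argmin (m d k : nat) (X : 'M[R]_(m, d)) (Y : 'M[R]_(m, k))
    (B : 'M[R]_(d, k)) :
  X^T *m X \in unitmx -> B != least_squares X Y ->
  sqerr X Y (least_squares X Y) < sqerr X Y B.
Proof.
move=> uX neqB; set C := least_squares X Y.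
have trE p q (M : 'M[R]_(p, q)) : \sum_i \sum_j M i j ^+ 2 = \tr (M^T *m M).
  rewrite exchange_big/=; apply: eq_bigr => j _; rewrite !mxE.
  by apply: eq_bigr => i _; rewrite !mxE expr2.
have orth : X^T *m (X *m C - Y) = 0.
  by rewrite mulmxBr /C /least_squares mulmxA -[invmx _ *m _ *m Y]mulmxA mulKVmx// subrr.
pose D := X *m (B - C); pose E : 'M[R]_(m, k) := X *m C - Y.
have DE : D^T *m E = 0 by rewrite /D trmx_mul -mulmxA orth mulmx0.
have ED : E^T *m D = 0 by rewrite -[D]trmxK -trmx_mul DE trmx0.
have XBE : X *m B - Y = D + E by rewrite /D /E mulmxBr addrA subrK.
rewrite /sqerr !trE -/E XBE [(D + E)^T]linearD/= mulmxDl.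
rewrite (mulmxDr D^T) (mulmxDr E^T) DE ED.
rewrite addr0 add0r mxtraceD -[\tr (D^T *m D)]trE ltrDr lt_neqAle.
rewrite sumr_ge0 ?andbT; last by move=> i _; apply: sumr_ge0 => j _; exact: sqr_ge0.
apply: contra neqB; rewrite eq_sym => /eqP D0.
have {}D0 : D = 0.
  apply/matrixP => i j; rewrite [RHS]mxE; apply/eqP; rewrite -sqrf_eq0; apply/eqP.
  have r0 i' : true -> 0 <= \sum_j' D i' j' ^+ 2.
    by move=> _; apply: sumr_ge0 => j' _; exact: sqr_ge0.
  have /psumr_eq0P := D0 => /(_ r0) /(_ i isT) /psumr_eq0P.
  by apply=> // j' _; exact: sqr_ge0.
have : (X^T *m X) *m (B - C) = 0 by rewrite -mulmxA -/D D0 mulmx0.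
move=> /(congr1 (mulmx (invmx (X^T *m X)))).
by rewrite mulKmx// mulmx0 => /eqP; rewrite subr_eq0.
Qed.

(* A draw is (X_1, ..., X_T, Y) with T = n.+1 and X_(t+1) at index t : 'I_n.+1;
   a dataset is an m-indexed family of draws. *)
Definition draw (d n : nat) : Type := (n.+1.-tuple 'cV[R]_d * R)%type.

HB.instance Definition _ (d n : nat) :=
  Measurable.on (draw d n).

Variables m d n : nat.
Implicit Type D : 'I_m -> draw d n.

Definition design D (t : 'I_n.+1) : 'M[R]_(m, d) :=
  \matrix_(i, j) tnth (D i).1 t j 0.

Definition response D : 'cV[R]_m := \col_i (D i).2.

Definition theta_OLS D : 'cV[R]_d :=
  least_squares (design D ord0) (response D).

Definition theta_LuPTS D : 'cV[R]_d :=
  (\prod_(t < n) least_squares (design D (widen_ord (leqnSn n) t))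
                               (design D (lift ord0 t)))
  *m least_squares (design D ord_max) (response D).

End estimators.

Section risks.
Context {dO : measure_display} {Omega : measurableType dO} {R : realType}.
Variables (P : probability Omega R) (d : nat) (est : Omega -> 'cV[R]_d).

Definition MSE (theta : 'cV[R]_d) : \bar R :=
  'E_P[fun w => sqnorm2 (est w - theta)].

(* The fresh draw (X1, Y) lives on its own probability space, so that it is
   independent of the data. *)
Definition expected_risk {dO0 : measure_display} {Omega0 : measurableType dO0}
    (P0 : probability Omega0 R) (X1 : Omega0 -> 'cV[R]_d) (Y : Omega0 -> R) :
    \bar R :=
  (\int[P]_w 'E_P0[fun w0 => ((dotv (est w) (X1 w0) - Y w0) ^+ 2)%R])%E.

End risks.

(* Main.v *)
From HB Require Import structures.
Require Import Defs.
From mathcomp Require Import all_boot all_order all_algebra.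
From mathcomp Require Import all_classical all_reals all_analysis.
From mathcomp Require Import measurable_realfun ring lra.

Set Implicit Arguments.
Unset Strict Implicit.
Unset Printing Implicit Defensive.
Import Order.TTheory GRing.Theory Num.Theory.
Import numFieldNormedType.Exports.
Local Open Scope classical_set_scope.
Local Open Scope ring_scope.

(* Let H_t be the orthogonal projection onto the column space of X_t, and let
   theta_k = Ahat_1 ... Ahat_k (X_(k+1)^T X_(k+1))^-1 X_(k+1)^T Y, so that theta_0
   is the OLS estimator and theta_(T-1) the LuPTS one.  Given X_1, ..., X_(k+2),
   the later noise is isotropic, so its law is unchanged when the orthogonal
   reflection Q = 2 H_(k+2) - 1 is applied to it.  This transformation replaces
   X_s by Q X_s for s >= k+2 and Y by Q Y; it fixes the LuPTS estimator and maps
   theta_k to 2 theta_(k+1) - theta_k.  Hence theta_(k+1) is the average of two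
   copies of theta_k with the same joint law with LuPTS, which gives both that
   LuPTS is square integrable and that E[OLS | LuPTS] = LuPTS.  The identities
   for the MSE and, with the test point fixed, for the risk are then Pythagoras'
   theorem.  Unbiasedness of OLS follows from the reflection Q = -1 of the whole
   noise.

   The rotation invariance of the Gaussian is obtained from translations: after
   division by the density, the law of each noise entry is invariant under
   translations, and a law on R^m with this property for the radial weight
   exp(|x|^2 / 2 s^2) is unique, by Fubini. *)

(** * Measurability of matrix operations *)

(** Only the OLS estimator is known to have second moments; the factors of LuPTS come with no moment
    bound, so its integrability cannot be obtained factor by factor. Projecting the noise by H would
    change its law, whereas 2H - 1 preserves it and still yields H as its average with the identity.
    The reflections multiply noise matrices from the left: they mix the m samples inside each
    column, whose entries are i.i.d. centred Gaussians, so columns with different variances can be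
    rotated together. The reflection is itself random, but it is a function of covariates that it
    leaves unchanged. No conditional law given the past is ever formed: conditioning is expressed by
    replacing a component with an independent copy ([refresh]) and by Tonelli. All invariance
    statements concern nonnegative functions with values in the extended reals. Hence they
    presuppose no integrability, and they make sense for the weighted noise law, which is
    Lebesgue-like and infinite. *)

Lemma measurable_invr (R : realType) : measurable_fun [set: R] (fun x : R => x^-1).
Proof.
have mX : measurable_fun [set: R] (fun x : R => x ^+ 2) by exact: measurable_funX.
have mp : measurable_fun [set: R] (fun x : R => (x ^+ 2) `^ (-1)).
  exact: (measurableT_comp (measurable_powR (-1)) mX).
(* The real power inverts nonnegative numbers only, hence the detour through the square; at 0 both
   sides vanish because [0^-1 = 0]. *)
rewrite (_ : (fun x : R => _) = fun x => x * (x ^+ 2) `^ (-1)); last first.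
  apply/funext => x; rewrite powR_inv1 ?sqr_ge0//.
  have [->|x0] := eqVneq x 0; first by rewrite invr0 mul0r.
  by rewrite expr2 invfM mulVKf.
exact: measurable_funM.
Qed.

Section measurable_matrix.
Context {R : realType} {dT : measure_display} {T : measurableType dT}.

Lemma measurable_mxP (m n : nat) (f : T -> 'M[R]_(m, n)) :
  measurable_fun setT f <->
  forall i j, measurable_fun setT (fun x => f x i j).
Proof.
split=> [mf i j|mf].
  apply: (@measurableT_comp _ _ _ _ _ _ (fun M : 'M[R]_(m, n) => M i j)) => //.
  move=> _ B mB; rewrite setTI; apply: sub_sigma_algebra.
  by exists (i, j) => //; exists B => //; rewrite setTI.
apply: measurability; first by reflexivity.
move=> _ [B [[i j] _ [C mC <-]] <-]; rewrite !setTI.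
by have := mf i j measurableT _ mC; rewrite setTI.
Qed.

Lemma measurable_matrix_of (m n : nat) (f : T -> 'I_m -> 'I_n -> R) :
  (forall i j, measurable_fun setT (fun x => f x i j)) ->
  measurable_fun setT (fun x => \matrix_(i, j) f x i j).
Proof.
move=> mf; apply/measurable_mxP => i j.
by under eq_fun do rewrite mxE; exact: mf.
Qed.

Lemma measurable_mx_entry (m n : nat) (f : T -> 'M[R]_(m, n)) i j :
  measurable_fun setT f -> measurable_fun setT (fun x => f x i j).
Proof. by move=> /measurable_mxP. Qed.

Lemma measurable_addmx (m n : nat) (f g : T -> 'M[R]_(m, n)) :
  measurable_fun setT f -> measurable_fun setT g ->
  measurable_fun setT (fun x => f x + g x).
Proof.
move=> /measurable_mxP mf /measurable_mxP mg; apply/measurable_mxP => i j.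
by under eq_fun do rewrite mxE; exact: measurable_funD.
Qed.

Lemma measurable_scalemx (m n : nat) (a : T -> R) (f : T -> 'M[R]_(m, n)) :
  measurable_fun setT a -> measurable_fun setT f ->
  measurable_fun setT (fun x => a x *: f x).
Proof.
move=> ma /measurable_mxP mf; apply/measurable_mxP => i j.
by under eq_fun do rewrite mxE; exact: measurable_funM.
Qed.

Lemma measurable_oppmx (m n : nat) (f : T -> 'M[R]_(m, n)) :
  measurable_fun setT f -> measurable_fun setT (fun x => - f x).
Proof.
move=> mf; under eq_fun do rewrite -scaleN1r.
exact: measurable_scalemx.
Qed.

Lemma measurable_submx (m n : nat) (f g : T -> 'M[R]_(m, n)) :
  measurable_fun setT f -> measurable_fun setT g ->
  measurable_fun setT (fun x => f x - g x).
Proof. by move=> mf mg; apply/measurable_addmx/measurable_oppmx. Qed.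

Lemma measurable_trmx (m n : nat) (f : T -> 'M[R]_(m, n)) :
  measurable_fun setT f -> measurable_fun setT (fun x => (f x)^T).
Proof.
move=> /measurable_mxP mf; apply/measurable_mxP => i j.
by under eq_fun do rewrite mxE; exact: mf.
Qed.

Lemma measurable_mulmx (m n p : nat) (f : T -> 'M[R]_(m, n))
    (g : T -> 'M[R]_(n, p)) :
  measurable_fun setT f -> measurable_fun setT g ->
  measurable_fun setT (fun x => f x *m g x).
Proof.
move=> /measurable_mxP mf /measurable_mxP mg; apply/measurable_mxP => i j.
under eq_fun do rewrite mxE.
by apply: measurable_sum => k; exact: measurable_funM.
Qed.

Lemma measurable_det (n : nat) (f : T -> 'M[R]_n) :
  measurable_fun setT f -> measurable_fun setT (fun x => \det (f x)).
Proof.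
move=> /measurable_mxP mf; rewrite /determinant; apply: measurable_sum => s.
apply: measurable_funM => //.
by apply: measurable_prod => i _; exact: mf.
Qed.

Lemma measurable_invmx (n : nat) (f : T -> 'M[R]_n) :
  measurable_fun setT f -> measurable_fun setT (fun x => invmx (f x)).
Proof.
move=> mf; have md := measurable_det mf.
(* Cramer's formula off the singular matrices, on which [invmx] returns its argument. *)
rewrite (_ : (fun x => _) = fun x => if \det (f x) == 0 then f x else
    (\det (f x))^-1 *: \adj (f x)); last first.
  apply/funext => x; rewrite /invmx unitmxE unitfE.
  by case: eqP.
apply: measurable_fun_ifT => //; first exact: measurable_fun_eqr.
apply: measurable_scalemx; first exact: (measurableT_comp (@measurable_invr R)).
apply/measurable_mxP => i j; under eq_fun do rewrite mxE.
apply: measurable_funM => //; apply: measurable_det; apply/measurable_mxP => k l.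
under eq_fun do rewrite !mxE.
exact: measurable_mx_entry.
Qed.

Lemma measurable_least_squares (m n k : nat) (X : T -> 'M[R]_(m, n))
    (Y : T -> 'M[R]_(m, k)) :
  measurable_fun setT X -> measurable_fun setT Y ->
  measurable_fun setT (fun x => least_squares (X x) (Y x)).
Proof.
move=> mX mY; have mXt := measurable_trmx mX.
apply: measurable_mulmx => //; apply: measurable_mulmx => //.
exact/measurable_invmx/measurable_mulmx.
Qed.

End measurable_matrix.

(** * Independence as resampling *)

Section refresh.
Local Open Scope ereal_scope.
Context {R : realType}.

Lemma ge0_integral_law {d d' dT} {O : measurableType d} {O' : measurableType d'}
    {T : measurableType dT} (P : {measure set O -> \bar R})
    (P' : {measure set O' -> \bar R}) (f : O -> T) (f' : O' -> T)
    (h : T -> \bar R) :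
  measurable_fun setT f -> measurable_fun setT f' ->
  (forall B, measurable B -> P (f @^-1` B) = P' (f' @^-1` B)) ->
  measurable_fun setT h -> (forall t, 0 <= h t) ->
  \int[P]_w h (f w) = \int[P']_w h (f' w).
Proof.
move=> mf mf' e mh h0.
pose F : {mfun O >-> T} := HB.pack f (isMeasurableFun.Build _ _ _ _ f mf).
pose F' : {mfun O' >-> T} := HB.pack f' (isMeasurableFun.Build _ _ _ _ f' mf').
have := @ge0_integral_pushforward _ _ _ _ R F mf P setT h measurableT mh.
rewrite preimage_setT => <-; last by move=> y _; exact: h0.
have := @ge0_integral_pushforward _ _ _ _ R F' mf' P' setT h measurableT mh.
rewrite preimage_setT => <-; last by move=> y _; exact: h0.
by apply: eq_measure_integral => A mA _; exact: e.
Qed.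

Section tonelli.
Context {d d'} {O : measurableType d} {O' : measurableType d'}.
Variables (m1 : {sigma_finite_measure set O -> \bar R})
  (m2 : {sigma_finite_measure set O' -> \bar R}) (f : O -> O' -> \bar R).
Hypothesis mf : measurable_fun setT (fun x => f x.1 x.2).
Hypothesis f0 : forall x y, 0 <= f x y.

Lemma measurable_ge0_integral : measurable_fun setT (fun x => \int[m2]_y f x y).
Proof.
exact: (@measurable_fun_fubini_tonelli_F _ _ _ _ R m2 _ mf (fun=> f0 _ _)).
Qed.

Lemma ge0_integral_swap :
  \int[m1]_x \int[m2]_y f x y = \int[m2]_y \int[m1]_x f x y.
Proof.
exact: (@fubini_tonelli _ _ _ _ R m1 m2 _ mf (fun=> f0 _ _)).
Qed.

End tonelli.

(* Resampling: the component of [u] that [put] overwrites may be replaced by an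
   independent copy of [v] without changing the law of [u]. *)
Definition refresh {d d' dT dS} {O : measurableType d} {O' : measurableType d'}
    {T : measurableType dT} {S : measurableType dS}
    (P : set O -> \bar R) (u : O -> S) (P' : set O' -> \bar R)
    (v : O' -> T) (put : T -> S -> S) :=
  forall h : S -> \bar R, measurable_fun setT h -> (forall s, 0 <= h s) ->
  \int[P]_w h (u w) = \int[P]_w \int[P']_w' h (put (v w') (u w)).

(** Only the law of the fresh copy matters, so it may be drawn elsewhere: a data row from the model
    space, a noise coordinate from [normal_prob]. *)
Lemma refresh_law {d d' d'' dT dS} {O : measurableType d}
    {O' : measurableType d'} {O'' : measurableType d''}
    {T : measurableType dT} {S : measurableType dS}
    (P : {measure set O -> \bar R}) (u : O -> S)
    (P' : {measure set O' -> \bar R}) (v : O' -> T)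
    (P'' : {measure set O'' -> \bar R}) (v' : O'' -> T) (put : T -> S -> S) :
  measurable_fun setT v -> measurable_fun setT v' ->
  measurable_fun setT (fun x : T * S => put x.1 x.2) ->
  (forall B, measurable B -> P' (v @^-1` B) = P'' (v' @^-1` B)) ->
  refresh P u P' v put -> refresh P u P'' v' put.
Proof.
move=> mv mv' mput e rf h mh h0; rewrite rf//.
apply: eq_integral => w _.
apply: (ge0_integral_law (h := fun t => h (put t (u w)))) => //.
apply: (measurableT_comp mh).
exact: (measurableT_comp mput (pair2_measurable (u w))).
Qed.

(** If [v] is a component of [u] and [x] a component of [v], then [x] can be resampled directly
    inside [u]: refresh [v] on both sides, then refresh [x] within the fresh [v]. The commutation of
    [put] with [putT] and [putS] says that both routes write to the same place. *)
Lemma refresh_lift {d d' d'' dT dS dU} {O : measurableType d}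
    {O' : measurableType d'} {O'' : measurableType d''}
    {T : measurableType dT} {S : measurableType dS} {U : measurableType dU}
    (P : probability O R) (u : O -> S)
    (P' : probability O' R) (v : O' -> T)
    (P'' : probability O'' R) (x : O'' -> U)
    (put : T -> S -> S) (putT : U -> T -> T) (putS : U -> S -> S) :
  measurable_fun setT x ->
  measurable_fun setT (fun x : T * S => put x.1 x.2) ->
  measurable_fun setT (fun x : U * S => putS x.1 x.2) ->
  (forall y t s, put (putT y t) s = putS y (put t s)) ->
  refresh P u P' v put -> refresh P' v P'' x putT -> refresh P u P'' x putS.
Proof.
move=> mx mput mputS putput ru rv h mh h0.
have mh2 : measurable_fun setT (fun sz : S * O'' => h (putS (x sz.2) sz.1)).
  apply: (measurableT_comp mh).
  apply: (measurableT_comp (f := fun y : U * S => putS y.1 y.2)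
    (g := fun sz : S * O'' => (x sz.2, sz.1)) mputS).
  by apply: measurable_fun_pair => //=; exact: measurableT_comp.
have mH : measurable_fun setT (fun s => \int[P'']_z h (putS (x z) s)).
  exact: (measurable_ge0_integral P'' mh2 (fun _ _ => h0 _)).
rewrite ru// [RHS](ru _ mH)//; last by move=> s; exact: integral_ge0.
apply: eq_integral => w _.
rewrite (rv (fun t => h (put t (u w))))//; last first.
  apply: (measurableT_comp mh).
  exact: (measurableT_comp mput (pair2_measurable (u w))).
by apply: eq_integral => w' _; apply: eq_integral => z _; rewrite putput.
Qed.

Section indep.
Context {d} {O : measurableType d} (P : probability O R).
Context {K : finType} (G : K -> set (set O)) (i0 : K).
Hypothesis G_sigma : forall i, sigma_algebra setT (G i).
Hypothesis G_meas : forall i, G i `<=` measurable.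
Hypothesis G_indep : mutual_indep P G.

Definition sigma_others : set (set O) := <<s \bigcup_(i in [set i | i != i0]) G i >>.

Let G_T i : G i setT.
Proof. by have [? C _] := G_sigma i; rewrite -setC0 -setTD; exact: C. Qed.

Let G_setI i A B : G i A -> G i B -> G i (A `&` B).
Proof.
have [_ C U] := G_sigma i; have CC X : G i X -> G i (~` X).
  by move=> ?; rewrite -setTD; exact: C.
move=> GA GB; rewrite -[A `&` B]setCK setCI -bigcup2E; apply: (CC); apply: (U).
by move=> [|[|k]]; [exact: CC|exact: CC|case: (G_sigma i)].
Qed.

(** For fixed [A], both sides are finite measures in [B]. They agree on intersections of one event
    from each [G i] with [i != i0], a pi-system generating [sigma_others]. *)
Lemma mutual_indep_others A B : G i0 A -> sigma_others B ->
  P (A `&` B) = P A * P B.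
Proof.
move=> GA.
pose Pi : set (set O) := [set B | exists E : K -> set O,
  [/\ forall i, G i (E i), E i0 = setT & B = \bigcap_i E i]].
have mA : measurable A by exact: G_meas GA.
have capE (E : K -> set O) : (forall i, G i (E i)) ->
    P (\bigcap_i E i) = \prod_i P (E i).
  move=> GE; have := G_indep (J := [set: K]%SET) (E := E) (fun i _ => GE i).
  rewrite (_ : [set` [set: K]%SET] = setT); last first.
    by apply/seteqP; split => // i _ /=; rewrite inE.
  by move=> ->; apply: eq_bigl => i; rewrite inE.
have fPA : P A = (fine (P A))%:E by rewrite fineK// fin_num_measure.
have PA0 : (0 <= fine (P A))%R by exact: fine_ge0.
have PiE B' : Pi B' -> mrestr P mA B' = mscale (NngNum PA0) P B'.
  move=> [E [GE E0 ->]]; rewrite /mrestr /mscale/= -fPA.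
  (* The slot [i0] of [E] holds the whole space, so [A] can be put there and mutual independence
     applied to the full family. *)
  pose E' i := if i == i0 then A else E i.
  have -> : \bigcap_i E i `&` A = \bigcap_i E' i.
    apply/seteqP; split=> [x [Ex Ax] i _|x E'x].
      by rewrite /E'; case: eqP => // _; exact: Ex.
    split; last by have := E'x i0 I; rewrite /E' eqxx.
    move=> i _; have := E'x i I; rewrite /E'; have [->|//] := eqVneq i i0.
    by rewrite E0.
  rewrite (capE E)// (capE E'); last first.
    by move=> i; rewrite /E'; have [->|] := eqVneq i i0.
  rewrite (bigD1 i0)//= [in RHS](bigD1 i0)//= E0 probability_setT mul1e.
  rewrite {1}/E' eqxx; congr (_ * _); apply: eq_bigr => i /negPf.
  by rewrite /E' => ->.
have mPi : Pi `<=` measurable.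
  move=> _ [E [GE _ ->]]; apply: fin_bigcap_measurable => //.
  by move=> i _; exact: G_meas.
have sub : sigma_others `<=` <<s Pi >>.
  apply: smallest_sub; first exact: smallest_sigma_algebra.
  move=> X [k /= ki0 GX]; apply: sub_sigma_algebra.
  exists (fun i => if i == k then X else setT); split.
  - by move=> i; case: eqP => // ->.
  - by rewrite eq_sym (negPf ki0).
  - apply/seteqP; split=> [x Xx i _|x /(_ k I)]; first by case: eqP.
    by rewrite eqxx.
move=> /sub PiB.
have : mrestr P mA B = mscale (NngNum PA0) P B.
  apply: (g_sigma_algebra_measure_unique Pi mPi (fun=> setT)) => //.
  - by move=> i; exists (fun=> setT); split => //; rewrite bigcapT.
  - by apply/seteqP; split => // x _; exists 0%N.
  - move=> X Y [E [GE E0 ->]] [F [GF F0 ->]].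
    exists (fun i => E i `&` F i); split; [|by rewrite E0 F0 setIT|].
      by move=> i; exact: G_setI.
    by rewrite bigcapI.
  - by move=> k; rewrite -[X in X < _]/(P (setT `&` A)) setTI (le_lt_trans (probability_le1 _ _)) ?ltry.
by rewrite /mrestr /mscale/= -fPA setIC.
Qed.

Context {dT dS} {T : measurableType dT} {S : measurableType dS}.

(* [put v] forgets the [i0]-component of [u] and writes [v] there instead. *)
Lemma refresh_indep (f : O -> T) (u : O -> S) (put : T -> S -> S) (t0 : T) :
  G i0 = g_sigma_algebra_preimage f ->
  measurable_fun setT (fun x : T * S => put x.1 x.2) ->
  measurable_fun setT u ->
  (forall w, put (f w) (u w) = u w) ->
  (forall t t' s, put t (put t' s) = put t s) ->
  (forall B, measurable B -> sigma_others ((fun w => put t0 (u w)) @^-1` B)) ->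
  refresh P u P f put.
Proof.
move=> Gf mput mu putK putput mg h mh h0.
have mf : measurable_fun setT f.
  move=> _ B mB; apply: (G_meas (i := i0)).
  by rewrite Gf; exists B.
have mg' : measurable_fun setT (fun w => put t0 (u w)).
  exact: (measurableT_comp mput (measurableT_comp (pair1_measurable t0) mu)).
pose F : {mfun O >-> T} := HB.pack f (isMeasurableFun.Build _ _ _ _ f mf).
(* [g] is [u] with its [i0]-component blanked by an arbitrary constant. It is independent of [f],
   and [put (f w) (g w)] restores [u w]; the claim is then Tonelli for the product law of
   [(f, g)]. *)
pose g w := put t0 (u w).
pose U : {mfun O >-> S} := HB.pack g (isMeasurableFun.Build _ _ _ _ g mg').
pose fg w := (f w, g w).
have mfg : measurable_fun setT fg by exact: measurable_fun_pair.
pose FU : {mfun O >-> (T * S)%type} := HB.pack fg (isMeasurableFun.Build _ _ _ _ fg mfg).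
have mhp : measurable_fun setT (fun x : T * S => h (put x.1 x.2)).
  exact: (measurableT_comp mh mput).
have prodE X : measurable X ->
    ((distribution P F) \x (distribution P U)) X = distribution P FU X.
  apply: product_measure_unique => A B mA mB.
  rewrite /distribution/= /pushforward/= -mutual_indep_others//.
  - by rewrite Gf; exists A => //; rewrite setTI.
  - exact: mg.
transitivity (\int[P]_w h (put (FU w).1 (FU w).2)).
  by apply: eq_integral => w _; rewrite /= /g putput putK.
transitivity (\int[distribution P FU]_x h (put x.1 x.2)).
  by rewrite ge0_integral_distribution.
transitivity (\int[(distribution P F) \x (distribution P U)]_x h (put x.1 x.2)).
  by apply: eq_measure_integral => A mA _; exact/esym/prodE.
rewrite fubini_tonelli1// /fubini_F.
have mhp' : measurable_fun setT (fun x : S * T => h (put x.2 x.1)).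
  have ms : measurable_fun setT (fun x : S * T => (x.2, x.1)).
    exact: measurable_fun_pair.
  exact: (measurableT_comp mhp ms).
transitivity
    (\int[distribution P U]_s \int[distribution P F]_t h (put t s)).
  exact: (ge0_integral_swap _ _ mhp (fun _ _ => h0 _)).
rewrite ge0_integral_distribution//=; last first.
- by move=> s; exact: integral_ge0.
- exact: (measurable_ge0_integral (distribution P F) mhp' (fun _ _ => h0 _)).
apply: eq_integral => w _.
rewrite (@ge0_integral_distribution _ _ _ _ _ P F (fun t => h (put t (g w))))//=.
  by apply: eq_integral => w' _; rewrite /g putput.
apply: (measurableT_comp mh).
exact: (measurableT_comp mput (pair2_measurable (g w))).
Qed.

End indep.
End refresh.

(** * Rotation invariance of Gaussian columns *)

Section normal_shift.
Local Open Scope ereal_scope.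
Context {R : realType}.
Local Notation mu := (@lebesgue_measure R).

Lemma ge0_integral_normal_prob (m s : R) (h : R -> \bar R) :
  measurable_fun setT h -> (forall x, 0 <= h x) ->
  \int[normal_prob m s]_x h x = \int[mu]_x (h x * (normal_pdf m s x)%:E).
Proof.
move=> mh h0; have dom := normal_prob_dominates m s.
have if_ := Radon_Nikodym_SigmaFinite.f_integrable dom.
have mpdf : measurable_fun setT (EFin \o normal_pdf m s).
  by apply/measurable_EFinP; exact: measurable_normal_pdf.
rewrite -(Radon_Nikodym_SigmaFinite.change_of_variables dom)//.
apply: ae_eq_integral => //.
- by apply: emeasurable_funM => //; exact: measurable_int if_.
- exact: emeasurable_funM.
(* The Radon-Nikodym derivative and [normal_pdf] have the same integral over every measurable set,
   hence agree almost everywhere. *)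
- apply: ae_eqe_mul2l; apply: integral_ae_eq => // A _ mA.
  by rewrite -Radon_Nikodym_SigmaFinite.f_integral.
Qed.

Lemma ge0_integral_lebesgue_shift (a : R) (h : R -> \bar R) :
  measurable_fun setT h -> (forall x, 0 <= h x) ->
  \int[mu]_x h (x + a)%R = \int[mu]_x h x.
Proof.
move=> mh h0.
pose sh : R -> measurableTypeR R := fun x => (x + a)%R.
have msh : measurable_fun setT sh by exact: measurable_funD.
have -> : \int[mu]_x h x = \int[pushforward mu sh]_x h x.
  apply: eq_measure_integral => A mA _.
  apply: lebesgue_measure_unique => //= _ [[x y]] _ <-.
  rewrite /pushforward (_ : sh @^-1` _ = `]x - a, y - a]%classic)%R; last first.
    by apply/seteqP; split => z /=; rewrite !in_itv/= ltrBlDr lerBrDr.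
  by rewrite !lebesgue_measure_itv/= !lte_fin ltrD2r -!EFinB opprB addrA subrK.
by rewrite ge0_integral_pushforward.
Qed.

(* The weight cancels the Gaussian density up to a constant, which leaves the
   translation-invariant Lebesgue measure. *)
Lemma normal_weight_shift (s a : R) (h : R -> \bar R) : s != 0%R ->
  measurable_fun setT h -> (forall x, 0 <= h x) ->
  \int[normal_prob 0 s]_x (h (x + a)%R * (expR (x ^+ 2 / (s ^+ 2 *+ 2)))%:E) =
  \int[normal_prob 0 s]_x (h x * (expR (x ^+ 2 / (s ^+ 2 *+ 2)))%:E).
Proof.
move=> s0 mh h0.
have msh : measurable_fun setT (fun x : R => (x + a)%R) by exact: measurable_funD.
have mha : measurable_fun setT (fun x : R => h (x + a)%R) by exact: (measurableT_comp mh msh).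
have mw : measurable_fun setT (fun x : R => (expR (x ^+ 2 / (s ^+ 2 *+ 2)))%:E).
  apply/measurable_EFinP; apply: (measurableT_comp (@measurable_expR R)).
  by apply: measurable_funM => //; exact: measurable_funX.
have E g : measurable_fun setT g -> (forall x, 0 <= g x) ->
    \int[normal_prob 0 s]_x (g x * (expR (x ^+ 2 / (s ^+ 2 *+ 2)))%:E) =
    \int[mu]_x (g x) * (normal_peak s)%:E.
  move=> mg g0; rewrite ge0_integral_normal_prob//; last 2 first.
  - exact: emeasurable_funM.
  - by move=> x; rewrite mule_ge0// lee_fin expR_ge0.
  rewrite -ge0_integralZr//; last by rewrite lee_fin normal_peak_ge0.
  apply: eq_integral => x _; rewrite -muleA -EFinM; congr (_ * _%:E).
  rewrite normal_pdfE// /normal_fun subr0 mulrCA -expRD mulNr addrN expR0.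
  by rewrite mulr1.
by rewrite !E// ge0_integral_lebesgue_shift.
Qed.

End normal_shift.

Section gaussian_columns.
Local Open Scope ereal_scope.
Context {R : realType} {d dT} {O : measurableType d} {T : measurableType dT}.
Variables (P : probability O R) (m N : nat).
Variables (U : O -> T) (E : O -> 'M[R]_(m, N)).
Hypotheses (mU : measurable_fun setT U) (mE : measurable_fun setT E).
Variables (s : 'I_N -> R) (G : pred 'I_N).

Definition set_entry (i : 'I_m) (c : 'I_N) (y : R) (e : 'M[R]_(m, N)) :=
  \matrix_(k, l) (if (k == i) && (l == c) then y else e k l) : 'M[R]_(m, N).

Hypothesis G_neq0 : forall c, G c -> s c != 0%R.
Hypothesis fresh : forall i c, G c ->
  refresh P (fun w => (U w, E w)) (normal_prob 0 (s c))
    (id : measurableTypeR R -> R) (fun y x => (x.1, set_entry i c y x.2)).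

(** Minus the exponent in the joint Gaussian density of the columns in [G]. The weight [W] below
    cancels that density up to a constant, and [V] is the inverse of [W]. *)
Definition quad (e : 'M[R]_(m, N)) : R :=
  (\sum_(c | G c) (e^T *m e) c c / (s c ^+ 2 *+ 2))%R.

(** Right multiplication keeps the columns in [G] and annihilates the others, so
    [e + (e' - e) *m colmask] is [e] with its [G]-columns taken from [e']. *)
Definition colmask : 'M[R]_N := diag_mx (\row_c (G c)%:R).

Let W e := (expR (quad e))%:E.
Let V e := (expR (- quad e))%:E.

Lemma mul_maskE (e : 'M[R]_(m, N)) i c : (e *m colmask) i c = (e i c * (G c)%:R)%R.
Proof. by rewrite mul_mx_diag !mxE. Qed.

Lemma mask_idem : colmask *m colmask = colmask.
Proof.
apply/matrixP => i j; rewrite mul_mx_diag !mxE.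
by case: (eqVneq i j) => [->|]; rewrite ?mul0r//; case: (G j); rewrite ?mulr1 ?mulr0.
Qed.

Lemma mask_merge (e e' : 'M[R]_(m, N)) :
  (e + (e' - e) *m colmask) *m colmask = e' *m colmask.
Proof. by rewrite mulmxDl -mulmxA mask_idem mulmxBl addrC subrK. Qed.

Lemma eq_quad (e e' : 'M[R]_(m, N)) :
  (forall i c, G c -> e i c = e' i c) -> quad e = quad e'.
Proof.
move=> ee; apply: eq_bigr => c Gc; rewrite !mxE; congr (_ / _)%R.
by apply: eq_bigr => i _; rewrite !mxE ee.
Qed.

Lemma quad_mulmx (Q : 'M[R]_m) e : Q^T *m Q = 1%:M -> quad (Q *m e) = quad e.
Proof.
by move=> QQ; rewrite /quad trmx_mul -mulmxA (mulmxA Q^T) QQ mul1mx.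
Qed.

Lemma quadN e : quad (- e) = quad e.
Proof.
apply: eq_bigr => c _; rewrite !mxE; congr (_ / _)%R.
by apply: eq_bigr => k _; rewrite !mxE mulrNN.
Qed.

Let VW e : V e * W e = 1.
Proof. by rewrite /V /W -EFinM -expRD addNr expR0. Qed.

Let W0 e : 0 <= W e. Proof. by rewrite lee_fin expR_ge0. Qed.
Let V0 e : 0 <= V e. Proof. by rewrite lee_fin expR_ge0. Qed.

Let mquad dX (X : measurableType dX) (f : X -> 'M[R]_(m, N)) :
  measurable_fun setT f -> measurable_fun setT (fun x => quad (f x)).
Proof.
move=> mf; rewrite /quad.
under eq_fun do rewrite big_mkcond/=.
apply: measurable_sum => c; case: (G c) => //.
apply: measurable_funM => //; apply: measurable_mx_entry.
by apply: measurable_mulmx => //; exact: measurable_trmx.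
Qed.

Let mW dX (X : measurableType dX) (f : X -> 'M[R]_(m, N)) :
  measurable_fun setT f -> measurable_fun setT (fun x => W (f x)).
Proof.
move=> mf; apply/measurable_EFinP.
exact: (measurableT_comp (@measurable_expR R) (mquad mf)).
Qed.

Let mV dX (X : measurableType dX) (f : X -> 'M[R]_(m, N)) :
  measurable_fun setT f -> measurable_fun setT (fun x => V (f x)).
Proof.
move=> mf; apply/measurable_EFinP.
apply: (measurableT_comp (@measurable_expR R)).
exact: measurable_funN (mquad mf).
Qed.

Let set_entryD i c (a y : R) e :
  (set_entry i c y e + a *: delta_mx i c)%R = set_entry i c (y + a)%R e.
Proof.
apply/matrixP => k l; rewrite !mxE; case: andP => _ /=.
  by rewrite mulr1.
by rewrite mulr0 addr0.
Qed.

Let quad_set_entry i c y e : G c ->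
  quad (set_entry i c y e) =
  (quad (set_entry i c 0 e) + y ^+ 2 / (s c ^+ 2 *+ 2))%R.
Proof.
move=> Gc; rewrite /quad (bigD1 c)//= [in RHS](bigD1 c)//= addrAC; congr (_ + _)%R.
  rewrite -mulrDl; congr (_ / _)%R; rewrite !mxE (bigD1 i)//= [in RHS](bigD1 i)//=.
  rewrite !mxE !eqxx/= mulr0 add0r -expr2 addrC; congr (_ + _)%R.
  by apply: eq_bigr => k /negPf ki; rewrite !mxE ki.
apply: eq_bigr => l /andP[_ /negPf lc]; rewrite !mxE; congr (_ / _)%R.
by apply: eq_bigr => k _; rewrite !mxE lc andbF.
Qed.

Let mset_entry i c :
  measurable_fun setT (fun x : R * 'M[R]_(m, N) => set_entry i c x.1 x.2).
Proof.
apply/measurable_mxP => k l; under eq_fun do rewrite mxE.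
case: (_ && _); first exact: measurable_fst.
by apply: measurable_mx_entry; exact: measurable_snd.
Qed.

(** After the entry has been resampled as an independent Gaussian, [W] factors into a part free of
    that entry and the one-dimensional weight, and [normal_weight_shift] applies. *)
Let shift_entry (h : T * 'M[R]_(m, N) -> \bar R) (a : R) i c : G c ->
  measurable_fun setT h -> (forall x, 0 <= h x) ->
  \int[P]_w (h (U w, E w + a *: delta_mx i c)%R * W (E w)) =
  \int[P]_w (h (U w, E w) * W (E w)).
Proof.
move=> Gc mh h0.
have mha : measurable_fun setT
    (fun x : T * 'M[R]_(m, N) => h (x.1, x.2 + a *: delta_mx i c)%R).
  apply: (measurableT_comp mh); apply: measurable_fun_pair => //=.
  exact: measurable_addmx.
rewrite (@fresh i c Gc (fun x => h (x.1, x.2 + a *: delta_mx i c)%R * W x.2)); last 2 first.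
- by apply: emeasurable_funM => //; exact: mW.
- by move=> x; rewrite mule_ge0.
rewrite [RHS](@fresh i c Gc (fun x => h x * W x.2)); last 2 first.
- by apply: emeasurable_funM => //; exact: mW.
- by move=> x; rewrite mule_ge0.
apply: eq_integral => w _ /=.
have Wy y : W (set_entry i c y (E w)) =
    W (set_entry i c 0%R (E w)) * (expR (y ^+ 2 / (s c ^+ 2 *+ 2)))%:E.
  by rewrite /W quad_set_entry// expRD EFinM.
under eq_integral do rewrite Wy set_entryD muleA.
under [RHS]eq_integral do rewrite Wy muleA.
apply: (@normal_weight_shift R (s c) a
  (fun y => h (U w, set_entry i c y (E w)) * W (set_entry i c 0%R (E w)))).
- exact: G_neq0.
- apply: emeasurable_funM => //.
  apply: (measurableT_comp mh); apply: measurable_fun_pair => //=.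
  exact: (measurableT_comp (mset_entry i c) (pair2_measurable (E w))).
- by move=> y; rewrite mule_ge0.
Qed.

Let shift_mask (a : 'M[R]_(m, N)) (h : T * 'M[R]_(m, N) -> \bar R) :
  measurable_fun setT h -> (forall x, 0 <= h x) ->
  \int[P]_w (h (U w, E w + a *m colmask)%R * W (E w)) =
  \int[P]_w (h (U w, E w) * W (E w)).
Proof.
move: h; rewrite (matrix_sum_delta (a *m colmask)).
(* Admissible translations are closed under addition, so it suffices to treat the single-entry
   summands of the masked matrix; those outside [G] are zero. *)
pose inv b := forall h : T * 'M[R]_(m, N) -> \bar R,
  measurable_fun setT h -> (forall x, 0 <= h x) ->
  \int[P]_w (h (U w, E w + b)%R * W (E w)) = \int[P]_w (h (U w, E w) * W (E w)).
have inv0 : inv 0%R by move=> h mh h0; under eq_integral do rewrite addr0.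
have invD b b' : inv b -> inv b' -> inv (b + b')%R.
  move=> ib ib' h mh h0; under eq_integral do rewrite addrA.
  have mhb : measurable_fun setT
      (fun x : T * 'M[R]_(m, N) => h (x.1, x.2 + b')%R).
    apply: (measurableT_comp mh); apply: measurable_fun_pair => //=.
    exact: measurable_addmx.
  by rewrite -(ib' h mh h0); exact: (ib _ mhb (fun=> h0 _)).
apply: (big_ind inv) => // i _; apply: (big_ind inv) => // c _.
rewrite mul_maskE; case: (boolP (G c)) => [Gc|_]; last by rewrite mulr0 scale0r.
by move=> h mh h0; exact: shift_entry.
Qed.

Let mUp : measurable_fun setT (fun x : O * O => U x.1).
Proof. exact: (measurableT_comp mU). Qed.
Let mE1 : measurable_fun setT (fun x : O * O => E x.1).
Proof. exact: (measurableT_comp mE). Qed.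
Let mE2 : measurable_fun setT (fun x : O * O => E x.2).
Proof. exact: (measurableT_comp mE). Qed.

Section fixed_orthogonal.
Variables (Q : 'M[R]_m) (h : T * 'M[R]_(m, N) -> \bar R).
Hypotheses (QtQ : Q^T *m Q = 1%:M) (mh : measurable_fun setT h).
Hypothesis h0 : forall x, 0 <= h x.

Let QQt : Q *m Q^T = 1%:M. Proof. exact: mulmx1C. Qed.

(** On the masked columns [Q] carries [e' + Q^T *m e] to [e + Q *m e'], and [quad] does not change
    under [Q]. *)
Let quad_swap (e e' : 'M[R]_(m, N)) :
  quad (e' + Q^T *m e *m colmask) = quad (e + Q *m e' *m colmask).
Proof.
rewrite (@eq_quad _ (e' + Q^T *m e)); last first.
  by move=> i c Gc; rewrite [LHS]mxE mul_maskE Gc mulr1 [RHS]mxE.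
rewrite -(@quad_mulmx Q)// mulmxDr mulmxA QQt mul1mx addrC; apply: eq_quad.
by move=> i c Gc; rewrite [RHS]mxE mul_maskE Gc mulr1 [LHS]mxE.
Qed.

(* Weighted by [W], the law of the noise is invariant under translations of the
   masked columns.  Shifting first [E w'], then [E w], then [E w'] again, and
   exchanging the integrals in between, turns the right-hand side into the left
   one.  With [h] a function of the masked columns only, this is the invariance
   of their law under [Q]. *)
Lemma resample_columns :
  \int[P]_w h (U w, E w) =
  \int[P]_w \int[P]_w' h (U w, E w + (Q *m E w' - E w) *m colmask)%R.
Proof.
pose F x := h x * V x.2.
have mF : measurable_fun setT F by apply: emeasurable_funM => //; exact: mV.
have F0 x : 0 <= F x by rewrite mule_ge0.
have hE x : h x = F x * W x.2 by rewrite /F -muleA VW mule1.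
have mFs : measurable_fun setT
    (fun x : O * O => F (U x.1, E x.1 + Q *m E x.2 *m colmask)%R).
  apply: (measurableT_comp mF); apply: measurable_fun_pair => //=.
  by apply: measurable_addmx => //; do 2![apply: measurable_mulmx => //].
have mVs : measurable_fun setT
    (fun x : O * O => V (E x.1 - Q *m E x.2 *m colmask)%R).
  apply: mV; apply: measurable_submx => //.
  by do 2![apply: measurable_mulmx => //].
(* For fixed [w], the inserted factor [V (E w - Q *m E w' *m colmask) * W (E w')] integrates to 1
   over [w']: shifting [E w'] by [Q^T *m E w] leaves [- Q *m E w'] as the argument of [V] on the
   masked columns, and [V] is even and invariant under [Q]. *)
transitivity (\int[P]_w \int[P]_w'
    (F (U w, E w) * V (E w - Q *m E w' *m colmask)%R * W (E w) * W (E w'))).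
  apply: eq_integral => w _.
  have -> : \int[P]_w' (F (U w, E w) * V (E w - Q *m E w' *m colmask)%R *
      W (E w) * W (E w')) =
      \int[P]_w' (h (U w, E w) * (V (E w - Q *m E w' *m colmask)%R * W (E w'))).
    by apply: eq_integral => w' _; rewrite hE/= [in RHS]muleA; congr (_ * _); rewrite muleAC.
  have mVw : measurable_fun setT (fun e => V (E w - Q *m e *m colmask)%R).
    apply: mV; apply: measurable_submx => //.
    by do 2![apply: measurable_mulmx => //].
  rewrite ge0_integralZl//; last 2 first.
  - apply: emeasurable_funM; last exact: mW.
    exact: (measurableT_comp mVw mE).
  - by move=> w' _; rewrite mule_ge0.
  rewrite -(shift_mask (Q^T *m E w)
    (h := fun x => V (E w - Q *m x.2 *m colmask)%R))//; last first.
    exact: (measurableT_comp mVw measurable_snd).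
  rewrite (_ : \int[P]_w' _ = 1) ?mule1//.
  rewrite -[RHS](@probability_setT _ _ _ P) -[RHS]mul1e -integral_cst//.
  apply: eq_integral => w' _; rewrite /= -(VW (E w')); congr (_ * _).
  rewrite /V mulmxDr !mulmxA QQt mul1mx mulmxDl -(mulmxA (E w)) mask_idem.
  rewrite (@eq_quad _ (- (Q *m E w'))) ?quadN ?quad_mulmx// => i c Gc.
  have M (x : 'M[R]_(m, N)) : (x *m colmask) i c = x i c.
    by rewrite mul_maskE Gc mulr1.
  rewrite [LHS]mxE [X in (_ + X)%R]mxE [X in (_ - X)%R]mxE !M [RHS]mxE.
  by rewrite opprD addrCA subrr addr0.
rewrite ge0_integral_swap//; last 2 first.
- do 2![apply: emeasurable_funM; last exact: mW].
  apply: emeasurable_funM => //; apply: (measurableT_comp mF).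
  exact: measurable_fun_pair.
- by move=> w w'; rewrite !mule_ge0.
(* With [w'] fixed, shifting [E w] by [Q *m E w'] turns the inserted [V] into [V (E w)], which
   cancels [W (E w)]. *)
transitivity (\int[P]_w \int[P]_w'
    (F (U w, E w + Q *m E w' *m colmask)%R * W (E w'))).
  transitivity (\int[P]_w' \int[P]_w
      (F (U w, E w + Q *m E w' *m colmask)%R * W (E w'))); last first.
    apply/esym/(ge0_integral_swap P P
      (f := fun w w' => F (U w, E w + Q *m E w' *m colmask)%R * W (E w'))).
    - by apply: emeasurable_funM => //; exact: mW.
    - by move=> w w'; rewrite mule_ge0.
  apply: eq_integral => w' _; set b := Q *m E w' *m colmask.
  have mFV : measurable_fun setT (fun x : T * 'M[R]_(m, N) => F x * V (x.2 - b)%R).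
    by apply: emeasurable_funM => //; apply: mV; exact: measurable_submx.
  rewrite !ge0_integralZr//; last 3 first.
  - apply: (measurableT_comp mF); apply: measurable_fun_pair => //.
    exact: measurable_addmx.
  - apply: emeasurable_funM; last exact: mW.
    apply: (measurableT_comp mFV); exact: measurable_fun_pair.
  - by move=> w _; rewrite !mule_ge0.
  congr (_ * _).
  rewrite -(shift_mask (Q *m E w') (h := fun x => F x * V (x.2 - b)%R))//; last first.
    by move=> x; rewrite mule_ge0.
  by apply: eq_integral => w _; rewrite /= addrK -muleA VW mule1.
apply: eq_integral => w _.
have -> : \int[P]_w' h (U w, E w + (Q *m E w' - E w) *m colmask)%R =
    \int[P]_w' ((h (U w, E w + (Q *m E w' - E w) *m colmask)%R * V (E w')) * W (E w')).
  by apply: eq_integral => w' _; rewrite -muleA VW mule1.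
(* This shift of [E w'] adds the masked part of [E w] to [Q *m E w'], so that both sides evaluate
   [h] at the same point; [quad_swap] matches the factors [V]. *)
rewrite -[RHS](shift_mask (Q^T *m E w)
  (h := fun x => h (U w, E w + (Q *m x.2 - E w) *m colmask)%R * V x.2)); last 2 first.
- apply: emeasurable_funM; last exact: mV.
  apply: (measurableT_comp mh); apply: measurable_fun_pair => //.
  apply: measurable_addmx => //; apply: measurable_mulmx => //.
  by apply: measurable_submx => //; exact: measurable_mulmx.
- by move=> x; rewrite mule_ge0.
apply: eq_integral => w' _ /=.
have -> : (E w + (Q *m (E w' + Q^T *m E w *m colmask) - E w) *m colmask =
    E w + Q *m E w' *m colmask)%R.
  rewrite mulmxDr !mulmxA QQt mul1mx mulmxBl mulmxDl -(mulmxA (E w)) mask_idem.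
  by rewrite addrK.
have -> : V (E w' + Q^T *m E w *m colmask)%R = V (E w + Q *m E w' *m colmask)%R.
  by rewrite /V quad_swap.
by [].
Qed.

End fixed_orthogonal.

(** This replaces conditioning on the past: [Q] may be random provided it ignores the masked
    columns. Resampling these with the identity matrix makes [Q] constant in the inner integral,
    where the case of a fixed orthogonal matrix applies. *)
Lemma integral_rotate_columns (Q : T * 'M[R]_(m, N) -> 'M[R]_m)
    (h : T * 'M[R]_(m, N) -> \bar R) :
  measurable_fun setT Q -> (forall x, (Q x)^T *m Q x = 1%:M) ->
  (forall x e a, Q (x, e + a *m colmask)%R = Q (x, e)) ->
  measurable_fun setT h -> (forall x, 0 <= h x) ->
  \int[P]_w h (U w, E w + (Q (U w, E w) *m E w - E w) *m colmask)%R =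
  \int[P]_w h (U w, E w).
Proof.
move=> mQ QQ Qmask mh h0.
have I1 : (1%:M : 'M[R]_m)^T *m 1%:M = 1%:M by rewrite trmx1 mulmx1.
pose tau (x : T * 'M[R]_(m, N)) := (x.1, x.2 + (Q x *m x.2 - x.2) *m colmask)%R.
have mtau : measurable_fun setT tau.
  apply: measurable_fun_pair => //; apply: measurable_addmx => //.
  apply: measurable_mulmx => //; apply: measurable_submx => //.
  exact: measurable_mulmx.
rewrite (resample_columns (h := fun x => h (tau x)) I1)//; last first.
  exact: (measurableT_comp mh mtau).
apply: etrans (esym (resample_columns I1 mh h0)).
apply: eq_integral => w _; set x := U w; set e := E w.
pose phi (e' : 'M[R]_(m, N)) := h (x, e + (e' - e) *m colmask)%R.
have mphi : measurable_fun setT phi.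
  apply: (measurableT_comp mh); apply: measurable_fun_pair => //.
  apply: measurable_addmx => //; apply: measurable_mulmx => //.
  exact: measurable_submx.
transitivity (\int[P]_w' phi (Q (x, e) *m E w')).
  apply: eq_integral => w' _; rewrite /phi /tau/= Qmask mul1mx; congr (h (_, _)%R).
  set q := Q (x, e); rewrite -addrA; congr (_ + _)%R.
  rewrite (mulmxBl (q *m _)) -(mulmxA q) mask_merge !mulmxBl mulmxA.
  by rewrite addrC addrA subrK.
under [RHS]eq_integral do rewrite mul1mx -/(phi _).
rewrite [RHS](resample_columns (QQ (x, e)) (h := fun y => phi y.2)); last 2 first.
- exact: (measurableT_comp mphi).
- by move=> y; exact: h0.
rewrite /=.
under [RHS]eq_integral => w1 _.
  under eq_integral => w2 _.
    rewrite (_ : phi _ = phi (Q (x, e) *m E w2)); last first.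
      rewrite /phi; congr (h (_, _)%R); congr (_ + _)%R.
      by rewrite (mulmxBl _ e) mask_merge -mulmxBl.
    over.
  over.
by rewrite /= integral_cst//= probability_setT mule1.
Qed.

End gaussian_columns.

(** * Reflections and the chain of estimators *)

Section reflection.
Variable R : realType.

(* The orthogonal reflection [2H - 1], [H] the projection onto the column space
   of [X]; the identity when [X] does not have full column rank. *)
Definition reflector (m d : nat) (X : 'M[R]_(m, d)) : 'M[R]_m :=
  if \det (X^T *m X) == 0 then 1%:M
  else 2 *: (X *m least_squares X 1%:M) - 1%:M.

Lemma hat_idem (m d : nat) (X : 'M[R]_(m, d)) : X^T *m X \in unitmx ->
  (X *m least_squares X 1%:M) *m X = X.
Proof.
by move=> uX; rewrite /least_squares mulmx1 -!mulmxA mulVmx// mulmx1.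
Qed.

Lemma hat_sym (m d : nat) (X : 'M[R]_(m, d)) :
  (X *m least_squares X 1%:M)^T = X *m least_squares X 1%:M.
Proof.
by rewrite /least_squares mulmx1 !trmx_mul trmxK trmx_inv trmx_mul trmxK mulmxA.
Qed.

Lemma reflector_sym (m d : nat) (X : 'M[R]_(m, d)) :
  (reflector X)^T = reflector X.
Proof.
rewrite /reflector; case: ifP => _; first by rewrite trmx1.
by rewrite linearB linearZ/= hat_sym trmx1.
Qed.

Lemma reflector_fix (m d : nat) (X : 'M[R]_(m, d)) : reflector X *m X = X.
Proof.
rewrite /reflector; case: ifPn => [_|dX]; first by rewrite mul1mx.
rewrite mulmxBl -scalemxAl hat_idem ?unitmxE ?unitfE//.
by rewrite scaler_nat mulr2n mul1mx addrK.
Qed.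

(** The default value of [reflector] makes this true for every [X], as [rotate_from_law] demands of
    a random rotation. *)
Lemma reflector_orth (m d : nat) (X : 'M[R]_(m, d)) :
  (reflector X)^T *m reflector X = 1%:M.
Proof.
rewrite reflector_sym {2}/reflector; case: ifPn => [dX|dX].
  by rewrite /reflector dX mulmx1.
rewrite mulmxBr -scalemxAr mulmxA reflector_fix mulmx1 /reflector (negPf dX).
by rewrite opprB addrC subrK.
Qed.

Lemma reflector_hat (m d : nat) (X : 'M[R]_(m, d)) (y : 'cV[R]_m) :
  X^T *m X \in unitmx ->
  X *m least_squares X y = 2^-1 *: (y + reflector X *m y).
Proof.
rewrite unitmxE unitfE /reflector => /negPf ->.
rewrite mulmxBl mul1mx addrC subrK -scalemxAl scalerA mulVf ?pnatr_eq0//.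
by rewrite scale1r /least_squares mulmx1 !mulmxA.
Qed.

Lemma least_squares_mulmx (m d p q : nat) (X : 'M[R]_(m, d)) (Y : 'M[R]_(m, p))
    (B : 'M[R]_(p, q)) :
  least_squares X (Y *m B) = least_squares X Y *m B.
Proof. by rewrite /least_squares mulmxA. Qed.

Lemma least_squaresD (m d p : nat) (X : 'M[R]_(m, d)) (Y Z : 'M[R]_(m, p)) :
  least_squares X (Y + Z) = least_squares X Y + least_squares X Z.
Proof. exact: mulmxDr. Qed.

Lemma least_squaresZ (m d p : nat) (X : 'M[R]_(m, d)) a (Y : 'M[R]_(m, p)) :
  least_squares X (a *: Y) = a *: least_squares X Y.
Proof. by rewrite /least_squares scalemxAr. Qed.

Lemma least_squares_id (m d p : nat) (X : 'M[R]_(m, d)) (B : 'M[R]_(d, p)) :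
  X^T *m X \in unitmx -> least_squares X (X *m B) = B.
Proof.
by move=> uX; rewrite /least_squares mulmxA -(mulmxA _ X^T) mulVmx// mul1mx.
Qed.

Lemma least_squares_orth (m d p : nat) (Q : 'M[R]_m) (X : 'M[R]_(m, d))
    (Y : 'M[R]_(m, p)) :
  Q^T *m Q = 1%:M -> least_squares (Q *m X) (Q *m Y) = least_squares X Y.
Proof.
move=> QQ; rewrite /least_squares trmx_mul -!mulmxA (mulmxA Q^T Q X).
by rewrite (mulmxA Q^T Q Y) QQ !mul1mx.
Qed.

(* [theta_seq X y 0] is the OLS estimator and [theta_seq X y n] the LuPTS one. *)
Definition theta_seq (m d : nat) (X : nat -> 'M[R]_(m, d)) (y : 'cV[R]_m)
    (k : nat) : 'cV[R]_d :=
  (\prod_(t < k) least_squares (X t) (X t.+1)) *m least_squares (X k) y.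

(* The reflection at X_(k+1) averages the last factor of [theta_seq X y k] to the
   projection onto the column space of X_(k+1). *)
Lemma theta_seq_reflect (m d k : nat) (X X' : nat -> 'M[R]_(m, d))
    (y : 'cV[R]_m) :
  (X k.+1)^T *m X k.+1 \in unitmx -> (forall t, (t <= k)%N -> X' t = X t) ->
  theta_seq X y k.+1 = 2^-1 *:
    (theta_seq X y k + theta_seq X' (reflector (X k.+1) *m y) k).
Proof.
move=> uX XX'; rewrite /theta_seq.
rewrite (_ : \prod_(t < k) least_squares (X' t) (X' t.+1) =
    \prod_(t < k) least_squares (X t) (X t.+1)); last first.
  by apply: eq_bigr => t _; rewrite !XX'// ltnW.
rewrite XX'// -mulmxDr -least_squaresD scalemxAr -least_squaresZ -reflector_hat//.
by rewrite least_squares_mulmx big_ord_recr/= -mulmxE -mulmxA.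
Qed.

(** The two ranges overlap at [t = k], where [Q] fixes [X k]. Hence each factor has both of its
    arguments unrotated or both rotated, and a common orthogonal [Q] cancels from least squares. *)
Lemma theta_seq_invariant (m d k n : nat) (Q : 'M[R]_m)
    (X X' : nat -> 'M[R]_(m, d)) (y : 'cV[R]_m) :
  (k <= n)%N -> Q^T *m Q = 1%:M ->
  (forall t, (t <= k)%N -> X' t = X t) ->
  (forall t, (k <= t <= n)%N -> X' t = Q *m X t) ->
  theta_seq X' (Q *m y) n = theta_seq X y n.
Proof.
move=> kn QQ X1 X2; rewrite /theta_seq X2 ?kn ?leqnn// least_squares_orth//.
congr (_ *m _); apply: eq_bigr => t _.
have [tk|kt] := ltnP t k; first by rewrite !X1// ltnW.
by rewrite !X2 ?least_squares_orth// ?kt ?(ltnW (ltn_ord t))// ltn_ord ltnW.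
Qed.

Lemma measurable_reflector {dT} {T : measurableType dT} (m d : nat)
    (X : T -> 'M[R]_(m, d)) :
  measurable_fun setT X -> measurable_fun setT (fun x => reflector (X x)).
Proof.
move=> mX; apply: measurable_fun_ifT => //.
  apply: measurable_fun_eqr => //; apply: measurable_det.
  by apply: measurable_mulmx => //; exact: measurable_trmx.
apply: measurable_submx => //; apply: measurable_scalemx => //.
by apply: measurable_mulmx => //; exact: measurable_least_squares.
Qed.

Lemma measurable_theta_seq {dT} {T : measurableType dT} (m d : nat)
    (X : T -> nat -> 'M[R]_(m, d)) (y : T -> 'cV[R]_m) (k : nat) :
  (forall t, measurable_fun setT (X ^~ t)) -> measurable_fun setT y ->
  measurable_fun setT (fun x => theta_seq (X x) (y x) k).
Proof.
move=> mX my; apply: measurable_mulmx; last exact: measurable_least_squares.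
elim: k => [|k IH]; first by under eq_fun do rewrite big_ord0; exact: measurable_cst.
under eq_fun do rewrite big_ord_recr/=.
by apply: measurable_mulmx => //; exact: measurable_least_squares.
Qed.

End reflection.

(** * The dataset as a function of initial covariates and noise *)

Section noise_model.
Variables (R : realType) (m d n : nat) (A : 'I_n -> 'M[R]_d) (beta : 'cV[R]_d).

(* The columns of a noise matrix: [Some (t, j)] is coordinate j of the noise
   entering X_(t+2) and [None] is the noise of Y. *)
Definition noise_index : finType := option ('I_n * 'I_d).
Local Notation N := #|noise_index|.
Implicit Types (x : 'M[R]_(m, d)) (e : 'M[R]_(m, N)).

(** The index is a natural number so that [covariates] can recurse on it; steps outside the horizon
    receive the default value 0. *)
Definition noise_block e (t : nat) : 'M[R]_(m, d) :=
  \matrix_(i, j) oapp (fun t' : 'I_n => e i (enum_rank (Some (t', j) : noise_index)))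
    0 (insub t).

Definition noise_resp e : 'cV[R]_m := \col_i e i (enum_rank (None : noise_index)).

Fixpoint covariates x e (t : nat) : 'M[R]_(m, d) :=
  if t is t'.+1 then covariates x e t' *m oapp A 0 (insub t') + noise_block e t'
  else x.

Definition responses x e : 'cV[R]_m := covariates x e n *m beta + noise_resp e.

Definition theta_at (k : nat) (u : 'M[R]_(m, d) * 'M[R]_(m, N)) : 'cV[R]_d :=
  theta_seq (covariates u.1 u.2) (responses u.1 u.2) k.

(** The noise entering strictly after [covariates _ _ k]: block [t] feeds index [t.+1], so blocks
    with [k <= t] do not affect the covariates up to index [k]. *)
Definition from_step (k : nat) (c : noise_index) : bool :=
  if c is Some (t, _) then (k <= t)%N else true.

Lemma eq_covariates k x e e' :
  (forall i c, ~~ from_step k (enum_val c) -> e' i c = e i c) ->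
  forall t, (t <= k)%N -> covariates x e' t = covariates x e t.
Proof.
move=> e'e; elim=> [//|t IH] tk /=; rewrite IH ?(ltnW tk)//; congr (_ + _).
apply/matrixP => i j; rewrite !mxE; case: insubP => [t' _ t't|_] //=.
by rewrite e'e// enum_rankK/= t't -ltnNge.
Qed.

Section rotated.
Variables (k : nat) (Q : 'M[R]_m) (x : 'M[R]_(m, d)) (e e' : 'M[R]_(m, N)).
Hypothesis e'E : forall i c,
  e' i c = if from_step k (enum_val c) then (Q *m e) i c else e i c.

Lemma noise_block_rotated t : noise_block e' t =
  if (k <= t)%N then Q *m noise_block e t else noise_block e t.
Proof.
case: (boolP (k <= t)%N) => kt; apply/matrixP => i j; last first.
  rewrite !mxE; case: insubP => [t' _ t't|_] //=.
  by rewrite e'E enum_rankK/= t't (negPf kt).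
rewrite [LHS]mxE [RHS]mxE; under [RHS]eq_bigr do rewrite [noise_block _ _ _ _]mxE.
case: insubP => [t' _ t't|_] /=; last by rewrite big1// => l _; rewrite mulr0.
by rewrite e'E enum_rankK/= t't kt mxE.
Qed.

Lemma noise_resp_rotated : noise_resp e' = Q *m noise_resp e.
Proof.
apply/matrixP => i j; rewrite !mxE e'E enum_rankK/= mxE.
by apply: eq_bigr => l _; rewrite !mxE.
Qed.

Lemma covariates_past t : (t <= k)%N -> covariates x e' t = covariates x e t.
Proof. by apply: eq_covariates => i c /negPf; rewrite e'E => ->. Qed.

Hypothesis Qfix : Q *m covariates x e k = covariates x e k.

(** [Q] acts on samples from the left and [A] on coordinates from the right, so rotating the later
    noise propagates through the recursion once [Q] fixes the covariates at [k]. *)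
Lemma covariates_future t : (k <= t)%N ->
  covariates x e' t = Q *m covariates x e t.
Proof.
elim: t => [|t IH]; first by rewrite leqn0 => /eqP k0; move: Qfix; rewrite k0/=.
rewrite leq_eqVlt => /orP[/eqP <-|kt]; first by rewrite Qfix covariates_past.
by rewrite /= IH// noise_block_rotated -ltnS kt mulmxDr mulmxA.
Qed.

Lemma responses_rotated : (k <= n)%N -> responses x e' = Q *m responses x e.
Proof.
move=> kn; rewrite /responses covariates_future// noise_resp_rotated.
by rewrite mulmxDr mulmxA.
Qed.

End rotated.

Lemma measurable_noise_block {dT} {T : measurableType dT} (f : T -> 'M[R]_(m, N)) t :
  measurable_fun setT f -> measurable_fun setT (fun z => noise_block (f z) t).
Proof.
move=> mf; apply/measurable_mxP => i j; under eq_fun do rewrite mxE.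
case: (insub t : option 'I_n) => [t'|]; last exact: measurable_cst.
exact: measurable_mx_entry.
Qed.

Lemma measurable_covariates {dT} {T : measurableType dT} (f : T -> 'M[R]_(m, d))
    (g : T -> 'M[R]_(m, N)) t :
  measurable_fun setT f -> measurable_fun setT g ->
  measurable_fun setT (fun z => covariates (f z) (g z) t).
Proof.
move=> mf mg; elim: t => [//|t IH] /=.
apply: measurable_addmx; first exact: measurable_mulmx.
exact: measurable_noise_block.
Qed.

Lemma measurable_responses {dT} {T : measurableType dT} (f : T -> 'M[R]_(m, d))
    (g : T -> 'M[R]_(m, N)) :
  measurable_fun setT f -> measurable_fun setT g ->
  measurable_fun setT (fun z => responses (f z) (g z)).
Proof.
move=> mf mg; apply: measurable_addmx.
  by apply: measurable_mulmx => //; exact: measurable_covariates.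
apply/measurable_mxP => i j; under eq_fun do rewrite mxE.
exact: measurable_mx_entry.
Qed.

Lemma measurable_theta_at k : measurable_fun setT (theta_at k).
Proof.
apply: (measurable_theta_seq (X := fun u t => covariates u.1 u.2 t)).
  by move=> t; exact: measurable_covariates.
exact: measurable_responses.
Qed.

(** The responses are affine in the noise: opposite noises cancel in the sum, leaving twice the
    noise-free response. *)
Lemma responses_neg x e : responses x (- e) + responses x e =
  (x *m ((\prod_(t < n) A t) *m beta)) *+ 2.
Proof.
have blockN t : noise_block (- e) t = - noise_block e t.
  apply/matrixP => i j; rewrite !mxE; case: insubP => [t' _ _|_] /=.
    by rewrite mxE.
  by rewrite oppr0.
have covE t : (t <= n)%N -> covariates x (- e) t + covariates x e t =
    (x *m \prod_(s < t) oapp A 0 (insub (s : nat))) *+ 2.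
  elim: t => [_|t IH tn]; first by rewrite big_ord0 mulmx1 mulr2n.
  rewrite /= blockN addrACA addNr addr0 -mulmxDl IH ?(ltnW tn)//.
  by rewrite big_ord_recr/= !mulr2n mulmxDl mulmxA.
rewrite /responses.
have -> : noise_resp (- e) = - noise_resp e by apply/matrixP => i j; rewrite !mxE.
rewrite addrACA addNr addr0 -mulmxDl covE// !mulr2n mulmxDl mulmxA.
by under eq_bigr do rewrite valK/=.
Qed.

End noise_model.

(** * Square-integrable variables and conditional expectations *)

Section square_integrable.
Local Open Scope ereal_scope.
Context {R : realType} {d} {O : measurableType d} (P : probability O R).
Implicit Types f g : O -> R.

Definition L2 f := measurable_fun setT f /\ P.-integrable setT (fun w => (f w ^+ 2)%:E).

Lemma L2_measurable f : L2 f -> measurable_fun setT f.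
Proof. by case. Qed.

Lemma L2P f : measurable_fun setT f -> \int[P]_w (f w ^+ 2)%:E < +oo -> L2 f.
Proof.
move=> mf fi; split=> //; apply/integrableP; split.
  by apply/measurable_EFinP; exact: measurable_funX.
by under eq_integral do rewrite gee0_abs ?lee_fin ?sqr_ge0//.
Qed.

Lemma L2_lty f : L2 f -> \int[P]_w (f w ^+ 2)%:E < +oo.
Proof.
case=> _ /integrableP[_ fi].
rewrite (eq_integral (fun w => `|(f w ^+ 2)%:E|))// => w _.
by rewrite gee0_abs ?lee_fin ?sqr_ge0.
Qed.

Lemma L2_cst c : L2 (cst c).
Proof.
apply: L2P => //; rewrite (eq_integral (cst (c ^+ 2)%:E))//.
by rewrite integral_cst//= probability_setT mule1 ltry.
Qed.

Lemma L2_integrableM f g : L2 f -> L2 g ->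
  P.-integrable setT (fun w => (f w * g w)%:E).
Proof.
move=> [mf if_] [mg ig]; apply: le_integrable (integrableD measurableT if_ ig) => //.
  by apply/measurable_EFinP; exact: measurable_funM.
move=> w _; rewrite -[leLHS]/((`|f w * g w|%R)%:E).
rewrite -[leRHS]/((`|f w ^+ 2 + g w ^+ 2|%R)%:E) lee_fin normrM.
rewrite [leRHS]ger0_norm ?addr_ge0 ?sqr_ge0//.
have := sqr_ge0 (`|f w| - `|g w|)%R; rewrite -!(real_normK (num_real (_ w))).
have := normr_ge0 (f w); have := normr_ge0 (g w).
by move: `|f w|%R `|g w|%R => a b; nra.
Qed.

Lemma L2_integrable f : L2 f -> P.-integrable setT (fun w => (f w)%:E).
Proof.
move=> if_; have := L2_integrableM if_ (L2_cst 1).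
by apply: eq_integrable => // w _; rewrite /= mulr1.
Qed.

Lemma L2Z c f : L2 f -> L2 (fun w => c * f w)%R.
Proof.
move=> [mf if_]; split; first exact: measurable_funM.
have := integrableZl measurableT (c ^+ 2) if_.
by apply: eq_integrable => // w _; rewrite /= exprMn EFinM.
Qed.

Lemma L2D f g : L2 f -> L2 g -> L2 (fun w => f w + g w)%R.
Proof.
move=> lf lg; have [[mf if_] [mg ig]] := (lf, lg).
split; first exact: measurable_funD.
have ifg := integrableZl measurableT 2 (L2_integrableM lf lg).
have := integrableD measurableT (integrableD measurableT if_ ig) ifg.
apply: eq_integrable => // w _; rewrite /= -!EFinM -!EFinD; congr (_%:E).
by ring.
Qed.

Lemma L2B f g : L2 f -> L2 g -> L2 (fun w => f w - g w)%R.
Proof.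
move=> lf lg; have := L2D lf (L2Z (-1) lg).
by under eq_fun do rewrite mulN1r.
Qed.

Lemma L2_sum (I : Type) (r : seq I) (f : I -> O -> R) :
  (forall i, L2 (f i)) -> L2 (fun w => \sum_(i <- r) f i w)%R.
Proof.
move=> lf; elim: r => [|i r IH].
  by under eq_fun do rewrite big_nil; exact: L2_cst.
by under eq_fun do rewrite big_cons; exact: L2D.
Qed.

Lemma eq_L2 f g : measurable_fun setT g -> {ae P, forall w, f w = g w} ->
  L2 f -> L2 g.
Proof.
move=> mg fg [mf if_]; apply: L2P => //.
rewrite -(@ae_eq_integral _ _ _ P setT _ (fun w => (f w ^+ 2)%:E))//; last 3 first.
- by apply/measurable_EFinP; exact: measurable_funX.
- by apply/measurable_EFinP; exact: measurable_funX.
- by apply: filterS fg => w /= -> _.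
exact: L2_lty.
Qed.

End square_integrable.

(** * Existence and uniqueness of conditional expectations *)

Section conditional_expectation.
Local Open Scope ereal_scope.
Context {R : realType} {d dT} {O : measurableType d} {T : measurableType dT}.
Variables (P : probability O R) (L : O -> T).
Hypothesis mL : measurable_fun setT L.

Lemma sigma_preimageE A : g_sigma_algebra_preimage L A ->
  exists2 B, measurable B & A = L @^-1` B.
Proof. by case=> B mB <-; exists B => //; rewrite setTI. Qed.

Lemma sigma_preimage_measurable A : g_sigma_algebra_preimage L A -> measurable A.
Proof. by move=> /sigma_preimageE[B mB ->]; rewrite -[X in measurable X]setTI; exact: mL. Qed.

(** Radon-Nikodym is applied on the target space [T]: the measure sending [B] to the integral of [f]
    over the preimage of [B] is dominated by the law of [L]. Its density composed with [L] is
    measurable for the sigma-algebra of [L] by construction. *)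
Lemma ge0_cond_exp_exists (f : O -> R) :
  (forall w, (0 <= f w)%R) -> P.-integrable setT (EFin \o f) ->
  exists g, is_cond_exp P L f g.
Proof.
move=> f0 if_; have mf := measurable_int _ if_.
pose X : {mfun O >-> T} := HB.pack L (isMeasurableFun.Build _ _ _ _ L mL).
have mLB B : measurable B -> measurable (L @^-1` B).
  by move=> mB; rewrite -[X in measurable X]setTI; exact: mL.
pose nu B := \int[P]_(w in L @^-1` B) (f w)%:E.
have nu0 : nu set0 = 0 by rewrite /nu preimage_set0 integral_set0.
have nu_ge0 B : 0 <= nu B by apply: integral_ge0 => w _; rewrite lee_fin.
have nu_add : semi_sigma_additive nu.
  move=> F mF tF mUF; rewrite /nu preimage_bigcup ge0_integral_bigcup//=; last 4 first.
  - by move=> i; exact: mLB.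
  - exact: measurable_funTS.
  - by move=> w _; rewrite lee_fin.
  - by move=> i j _ _ [w [Fi Fj]]; apply: tF => //; exists (L w).
  apply: is_cvg_ereal_nneg_natsum_cond => i _ _.
  by apply: integral_ge0 => w _; rewrite lee_fin.
pose nuM : {measure set T -> \bar R} :=
  HB.pack nu (isMeasure.Build _ _ _ nu nu0 nu_ge0 nu_add).
have nu_fin : fin_num_fun nu.
  move=> B mB; apply: integrable_fin_num; first exact: mLB.
  by apply: (integrableS measurableT _ _ if_) => //; exact: mLB.
pose nuF : {finite_measure set T -> \bar R} :=
  HB.pack (Measure.sort nuM)
    (@Measure_isFinite.Build _ T R (Measure.sort nuM) nu_fin).
have dom : nuF `<< distribution P X.
  apply/null_content_dominatesP => B mB PB0.
  rewrite /nuF/= /nu; apply: null_set_integral => //.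
  - exact: mLB.
  - exact: measurable_funTS.
have [r [r0 rfin ir rE]] := radon_nikodym_sigma_finite dom.
have rK t : r t = (fine (r t))%:E by rewrite fineK.
have mr : measurable_fun setT (fine \o r).
  exact: measurableT_comp (measurable_int _ ir).
exists (fun w => fine (r (L w))); split.
- move=> B mB; exists ((fine \o r) @^-1` B); last by rewrite setTI.
  by rewrite -[X in measurable X]setTI; exact: mr.
- have ir' := ir; have /integrableP[mr' rfi] := ir'.
  apply/integrableP; split; first exact/measurable_EFinP/(measurableT_comp mr).
  apply: le_lt_trans rfi.
  rewrite (@ge0_integral_distribution _ _ _ _ _ P X (fun x => `|r x|))//; last first.
    exact: measurableT_comp.
  rewrite le_eqVlt; apply/orP; left; apply/eqP.
  by apply: eq_integral => w _ /=; rewrite [in RHS]rK.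
- move=> A /sigma_preimageE[B mB ->].
  rewrite -[RHS]/(nuF B) rE// ge0_integral_pushforward//; last first.
    by apply: measurable_funTS; exact: measurable_int ir.
  by apply: eq_integral => w _; rewrite /= -rK.
Qed.

Lemma is_cond_exp_measurable f g : is_cond_exp P L f g -> measurable_fun setT g.
Proof.
by move=> [gL _ _] _ B mB; rewrite setTI; exact/sigma_preimage_measurable/gL.
Qed.

Lemma is_cond_exp_unique f g g' :
  is_cond_exp P L f g -> is_cond_exp P L f g' -> {ae P, forall w, g w = g' w}.
Proof.
move=> cg cg'.
(* The event [h < h'] belongs to the sigma-algebra of [L], and [h' - h] integrates to 0 over it, so
   it is null. *)
have half h h' : is_cond_exp P L f h -> is_cond_exp P L f h' ->
    {ae P, forall w, (h w < h' w)%R -> h w = h' w}.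
  move=> ch ch'; have [mh mh'] := (is_cond_exp_measurable ch, is_cond_exp_measurable ch').
  have [hL ih hE] := ch; have [h'L ih' h'E] := ch'.
  pose A := [set w | (h w < h' w)%R].
  have LA : g_sigma_algebra_preimage L A.
    have mLh : measurable_fun [set: g_sigma_algebra_preimageType L] (h : g_sigma_algebra_preimageType L -> R).
      by move=> _ B mB; rewrite setTI; exact: hL.
    have mLh' : measurable_fun [set: g_sigma_algebra_preimageType L] (h' : g_sigma_algebra_preimageType L -> R).
      by move=> _ B mB; rewrite setTI; exact: h'L.
    have mt : measurable [set true] by [].
    by have := measurable_fun_ltr mLh mLh' measurableT mt; rewrite setTI.
  have mA := sigma_preimage_measurable LA.
  have iA k : P.-integrable setT (EFin \o k) -> P.-integrable A (EFin \o k).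
    exact: integrableS.
  have mk : measurable_fun A (fun w => (h' w - h w)%:E).
    by apply: measurable_funTS; apply/measurable_EFinP; exact: measurable_funB.
  have H0 : \int[P]_(w in A) `|(h' w - h w)%:E| = 0.
    transitivity (\int[P]_(w in A) ((h' w)%:E - (h w)%:E)).
      apply: eq_integral => w /set_mem Aw.
      by rewrite -EFinB gee0_abs// lee_fin subr_ge0 ltW.
    rewrite integralB//; [|exact: iA|exact: iA].
    by rewrite hE// h'E// subee// -h'E//; apply: integrable_fin_num => //; exact: iA.
  have [/(_ H0) H _] := ae_eq_integral_abs P mA mk.
  apply: filterS H => w H hw; have /(congr1 fine)/= := H hw.
  by move/eqP; rewrite subr_eq0 => /eqP.
have := half _ _ cg cg'; have := half _ _ cg' cg.
apply: filterS2 => w h1 h2.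
by have [/h2|/h1|] := ltgtP (g w) (g' w).
Qed.

Lemma cond_expP f g : is_cond_exp P L f g -> is_cond_exp P L f (cond_exp P L f).
Proof. by move=> cg; apply: xgetPex; exists g. Qed.

(** * Rao-Blackwell decomposition *)

Section rao_blackwell.
Variables f l : O -> R.
Variable lam : T -> R.
Hypotheses (mlam : measurable_fun setT lam) (lE : forall w, l w = lam (L w)).
Hypotheses (f2 : L2 P f) (l2 : L2 P l).
Hypothesis fl : forall psi : T -> R, measurable_fun setT psi ->
  L2 P (fun w => psi (L w)) ->
  \int[P]_w (f w * psi (L w))%:E = \int[P]_w (l w * psi (L w))%:E.

(** Indicators of preimages under [L] are square-integrable functions of [L], so [fl] contains the
    defining property of a conditional expectation. *)
Lemma orthogonal_is_cond_exp : is_cond_exp P L f l.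
Proof.
split.
- move=> B mB; exists (lam @^-1` B).
    by rewrite -[X in measurable X]setTI; exact: mlam.
  by apply/seteqP; split => w /=; rewrite lE// => -[].
- exact: L2_integrable.
- move=> A /sigma_preimageE[B mB ->].
  have mI : measurable_fun setT (\1_B : T -> R) by exact: measurable_indic.
  have I2 : L2 P (fun w => \1_B (L w)).
    apply: L2P; first exact: (measurableT_comp mI).
    apply: (@le_lt_trans _ _ (\int[P]_w 1)).
      apply: ge0_le_integral => //.
      + apply/measurable_EFinP; apply: measurable_funX.
        exact: (measurableT_comp mI).
      + by move=> w _; rewrite lee_fin indicE; case: (_ \in _); rewrite ?expr1n ?expr0n.
    by rewrite integral_cst//= probability_setT mule1 ltry.
  have E k : \int[P]_(w in L @^-1` B) (k w)%:E = \int[P]_w (k w * \1_B (L w))%:E.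
    rewrite integral_mkcond; apply: eq_integral => w _; rewrite patchE indicE.
    rewrite (_ : (w \in L @^-1` B) = (L w \in B)); last first.
      by apply/idP/idP => /set_mem Bw; exact/mem_set.
    by case: (_ \in _) => /=; rewrite ?mulr1 ?mulr0.
  by rewrite !E fl.
Qed.

Lemma cond_exp_ae : {ae P, forall w, cond_exp P L f w = l w}.
Proof.
have c := orthogonal_is_cond_exp.
exact: is_cond_exp_unique (cond_expP c) c.
Qed.

Let sqr_ae : {ae P, forall w, ((f w - l w) ^+ 2 = (f w - cond_exp P L f w) ^+ 2)%R}.
Proof. by apply: filterS cond_exp_ae => w ->. Qed.

(** [cond_exp] falls back to 0 when no version exists, so existence has to be shown for the squared
    residual: it is integrable because it agrees almost everywhere with the square of [f - l]. *)
Lemma cond_var_is_cond_exp :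
  is_cond_exp P L (fun w => (f w - cond_exp P L f w) ^+ 2)%R (cond_var P L f).
Proof.
have mc := is_cond_exp_measurable (cond_expP orthogonal_is_cond_exp).
have mfc : measurable_fun setT (fun w => f w - cond_exp P L f w)%R.
  by apply: measurable_funB => //; exact: L2_measurable f2.
have fc2 : L2 P (fun w => f w - cond_exp P L f w)%R.
  apply: eq_L2 (L2B f2 l2) => //.
  by apply: filterS cond_exp_ae => w ->.
have [g cg] : exists g, is_cond_exp P L (fun w => (f w - cond_exp P L f w) ^+ 2)%R g.
  apply: ge0_cond_exp_exists => [w|]; first exact: sqr_ge0.
  by case: fc2.
exact: cond_expP cg.
Qed.

Lemma integral_cond_var :
  \int[P]_w (cond_var P L f w)%:E = \int[P]_w ((f w - l w) ^+ 2)%:E.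
Proof.
have [_ _ ->] := cond_var_is_cond_exp; last by exists setT; rewrite ?setTI.
have mc := is_cond_exp_measurable (cond_expP orthogonal_is_cond_exp).
apply: ae_eq_integral => //.
- apply/measurable_EFinP; apply: measurable_funX; apply: measurable_funB => //.
  exact: L2_measurable f2.
- apply/measurable_EFinP; apply: measurable_funX.
  exact: measurable_funB (L2_measurable f2) (L2_measurable l2).
- by apply: filterS sqr_ae => w /= -> _.
Qed.

Lemma pythagoras (c : R) :
  \int[P]_w ((f w - c) ^+ 2)%:E =
  \int[P]_w ((l w - c) ^+ 2)%:E + \int[P]_w ((f w - l w) ^+ 2)%:E.
Proof.
have lc := L2B l2 (L2_cst P c); have fl2 := L2B f2 l2.
have icross := integrableZl measurableT 2 (L2_integrableM fl2 lc).
have il : P.-integrable setT (fun w => ((l w - c) ^+ 2)%:E) by case: lc.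
have ifl : P.-integrable setT (fun w => ((f w - l w) ^+ 2)%:E) by case: fl2.
transitivity (\int[P]_w (((l w - c) ^+ 2)%:E + ((f w - l w) ^+ 2)%:E +
    2%:E * ((f w - l w) * (l w - c))%:E)).
  apply: eq_integral => w _; rewrite -EFinM -!EFinD; congr (_%:E); ring.
rewrite integralD//; last exact: integrableD.
rewrite integralD// integralZl//; last exact: L2_integrableM.
rewrite [X in _ + 2%:E * X](_ : _ = 0) ?mule0 ?adde0//.
(* The cross term is the residual [f - l] times this function of [L], hence vanishes by [fl]. *)
pose psi t := (lam t - c)%R.
have mpsi : measurable_fun setT psi by exact: measurable_funB.
have psi2 : L2 P (fun w => psi (L w)).
  by rewrite (_ : (fun w => _) = fun w => l w - c)%R//; apply/funext => w; rewrite /psi lE.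
transitivity (\int[P]_w ((f w * psi (L w))%:E - (l w * psi (L w))%:E)).
  by apply: eq_integral => w _; rewrite -EFinB -mulrBl /psi lE.
rewrite integralB//; [|exact: L2_integrableM|exact: L2_integrableM].
by rewrite fl// subee//; apply: integrable_fin_num => //; exact: L2_integrableM.
Qed.

End rao_blackwell.
End conditional_expectation.

(** * Averaging over measure-preserving maps *)

Section averaging.
Local Open Scope ereal_scope.
Context {R : realType} {d dS dV} {O : measurableType d} {S : measurableType dS}
  {V : measurableType dV} (P : probability O R).

Lemma integral_invariant (u : O -> S) (tau : S -> S) (f : S -> \bar R) :
  (forall h : S -> \bar R, measurable_fun setT h -> (forall s, 0 <= h s) ->
    \int[P]_w h (tau (u w)) = \int[P]_w h (u w)) ->
  measurable_fun setT f -> \int[P]_w f (tau (u w)) = \int[P]_w f (u w).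
Proof.
move=> inv mf; rewrite integralE [RHS]integralE; congr (_ - _).
  rewrite (eq_integral (fun w => f^\+ (tau (u w)))); last first.
    by move=> w _; rewrite !funeposE.
  rewrite (inv _ (measurable_funepos mf) (fun s => funepos_ge0 f s)).
  by apply: eq_integral => w _; rewrite !funeposE.
rewrite (eq_integral (fun w => f^\- (tau (u w)))); last first.
  by move=> w _; rewrite !funenegE.
rewrite (inv _ (measurable_funeneg mf) (fun s => funeneg_ge0 f s)).
by apply: eq_integral => w _; rewrite !funenegE.
Qed.

Variables (u : O -> S) (L : S -> V) (th : nat -> S -> R) (tau : nat -> S -> S).
Variable n : nat.
Hypotheses (mu : measurable_fun setT u) (mL : measurable_fun setT L).
Hypotheses (mth : forall k, measurable_fun setT (th k))
  (mtau : forall k, measurable_fun setT (tau k)).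
Hypothesis tau_law : forall k, (k < n)%N -> forall h : S -> \bar R,
  measurable_fun setT h -> (forall s, 0 <= h s) ->
  \int[P]_w h (tau k (u w)) = \int[P]_w h (u w).
Hypothesis th_avg : forall k, (k < n)%N -> {ae P, forall w,
  (th k.+1 (u w) = 2^-1 * (th k (u w) + th k (tau k (u w))))%R}.
Hypothesis L_inv : forall k, (k < n)%N -> {ae P, forall w, L (tau k (u w)) = L (u w)}.
Hypothesis th0 : L2 P (fun w => th 0 (u w)).

Lemma average_orthogonal k : (k <= n)%N ->
  L2 P (fun w => th k (u w)) /\
  forall psi : V -> R, measurable_fun setT psi -> L2 P (fun w => psi (L (u w))) ->
    \int[P]_w (th 0 (u w) * psi (L (u w)))%:E =
    \int[P]_w (th k (u w) * psi (L (u w)))%:E.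
Proof.
elim: k => [//|k IH] kn; have [thk2 IHo] := IH (ltnW kn).
have mthu k' : measurable_fun setT (fun w => th k' (u w)) by exact: measurableT_comp.
have thtau2 : L2 P (fun w => th k (tau k (u w))).
  apply: L2P; first exact: (measurableT_comp (mth k) (measurableT_comp (mtau k) mu)).
  rewrite (tau_law kn (h := fun s => (th k s ^+ 2)%:E)).
  - exact: L2_lty.
  - by apply/measurable_EFinP; exact: measurable_funX.
  - by move=> s; rewrite lee_fin sqr_ge0.
have avg2 := L2Z 2^-1 (L2D thk2 thtau2).
split.
  by apply: eq_L2 avg2 => //; apply: filterS (th_avg kn) => w ->.
move=> psi mpsi psi2; rewrite IHo//.
have mpsiL : measurable_fun setT (fun s => psi (L s)) by exact: measurableT_comp.
have mpsiu : measurable_fun setT (fun w => psi (L (u w))) by exact: (measurableT_comp mpsiL).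
set I0 := LHS.
(* Applying [tau k] throughout the integrand of [I0] preserves the integral, and [L_inv] then
   removes [tau k] from the factor [psi]. *)
have tauE : \int[P]_w (th k (tau k (u w)) * psi (L (u w)))%:E = I0.
  rewrite /I0 -(integral_invariant (f := fun s => (th k s * psi (L s))%:E) (tau_law kn)).
    apply: ae_eq_integral => //.
    - by apply/measurable_EFinP; apply: measurable_funM => //; exact: L2_measurable thtau2.
    - apply/measurable_EFinP; apply: measurable_funM; first exact: L2_measurable thtau2.
      exact: (measurableT_comp mpsiL (measurableT_comp (mtau k) mu)).
    - by apply: filterS (L_inv kn) => w /= -> _.
  by apply/measurable_EFinP; exact: measurable_funM.
transitivity (\int[P]_w (2^-1%:E * ((th k (u w) * psi (L (u w)))%:E +
    (th k (tau k (u w)) * psi (L (u w)))%:E))).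
  rewrite integralZl//; last first.
    by apply: (integrableD measurableT); exact: L2_integrableM.
  rewrite integralD//; [|exact: L2_integrableM|exact: L2_integrableM].
  rewrite tauE -/I0.
  have /fineK <- : I0 \is a fin_num.
    by apply: integrable_fin_num => //; exact: L2_integrableM.
  by rewrite -EFinD -EFinM; congr (_%:E); field.
apply: ae_eq_integral => //.
- apply/measurable_EFinP; apply: measurable_funM => //.
  by apply: measurable_funD; apply: measurable_funM => //; exact: L2_measurable thtau2.
- by apply/measurable_EFinP; exact: measurable_funM.
- by apply: filterS (th_avg kn) => w /= -> _; rewrite -EFinD -EFinM -mulrDl mulrA.
Qed.

End averaging.

(** * Splitting a dataset into its initial covariates and its noise *)

Section others.
Context {R : realType} {d dS dT} {O : measurableType d} {S : measurableType dS}
  {T : measurableType dT}.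
Context {K : finType} (G : K -> set (set O)) (i0 : K).

(** The sample space carrying only the sigma-algebra of the other components, so that dependence on
    these alone becomes ordinary measurability. *)
Definition others_type : Type := g_sigma_algebraType (\bigcup_(i in [set i | i != i0]) G i).
HB.instance Definition _ := Measurable.on others_type.

Lemma others_ext (g g' : others_type -> S) :
  g =1 g' -> measurable_fun setT g -> measurable_fun setT g'.
Proof. by move=> /funext ->. Qed.

Lemma others_measurable (g : O -> S) :
  measurable_fun [set: others_type] (g : others_type -> S) ->
  forall B, measurable B -> sigma_others G i0 (g @^-1` B).
Proof. by move=> mg B mB; have := mg measurableT B mB; rewrite setTI. Qed.

Lemma others_measurable_comp k (f : O -> T) (g : T -> S) :
  k != i0 -> G k = g_sigma_algebra_preimage f -> measurable_fun setT g ->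
  measurable_fun [set: others_type] ((fun w => g (f w)) : others_type -> S).
Proof.
move=> ki0 Gk mg _ B mB; rewrite setTI; apply: sub_sigma_algebra.
exists k => //; rewrite Gk; exists (g @^-1` B); last by rewrite setTI.
by rewrite -[X in measurable X]setTI; exact: mg.
Qed.

End others.

Section dataset.
Variables (R : realType) (m d n : nat) (A : 'I_n -> 'M[R]_d) (beta : 'cV[R]_d).
Local Notation N := #|noise_index d n|.

(** The data space carries observations only. The noise is recovered as the residuals at the true
    parameters, which makes a draw an invertible function of its initial covariate and noise. *)
Definition draw_noise (q : draw R d n) : 'rV[R]_N :=
  \row_c match enum_val c with
  | Some (t, j) =>
      (tnth q.1 (lift ord0 t) - (A t)^T *m tnth q.1 (widen_ord (leqnSn n) t)) j 0
  | None => q.2 - dotv beta (tnth q.1 ord_max)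
  end.

Definition split_draw (q : draw R d n) : 'rV[R]_d * 'rV[R]_N :=
  ((tnth q.1 ord0)^T, draw_noise q).

Definition data_noise (D : 'I_m -> draw R d n) : 'M[R]_(m, N) :=
  \matrix_(i, c) draw_noise (D i) 0 c.

Definition split_data (D : 'I_m -> draw R d n) := (design D ord0, data_noise D).

Lemma design_covariates (D : 'I_m -> draw R d n) (t : 'I_n.+1) :
  covariates A (design D ord0) (data_noise D) t = design D t.
Proof.
case: t => t; elim: t => [|t IH] tn /=; first by congr design; exact: val_inj.
have tn' : (t < n)%N by [].
rewrite (IH (ltnW tn)) insubT/=; set s := Sub t tn'.
rewrite (_ : Ordinal tn = lift ord0 s); last exact: val_inj.
rewrite (_ : Ordinal (ltnW tn) = widen_ord (leqnSn n) s); last exact: val_inj.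
apply/matrixP => i j; rewrite !mxE insubT/= -/s !mxE enum_rankK !mxE.
rewrite addrCA -[RHS]addr0; congr (_ + _); apply/eqP; rewrite subr_eq0; apply/eqP.
by apply: eq_bigr => k _; rewrite !mxE mulrC.
Qed.

Lemma response_responses (D : 'I_m -> draw R d n) :
  responses A beta (design D ord0) (data_noise D) = response D.
Proof.
rewrite /responses (design_covariates D ord_max).
apply/matrixP => i j; rewrite !mxE enum_rankK addrCA -[RHS]addr0; congr (_ + _).
apply/eqP; rewrite subr_eq0; apply/eqP; apply: eq_bigr => k _.
by rewrite (ord1 j) !mxE mulrC.
Qed.

Lemma theta_OLS_at (D : 'I_m -> draw R d n) :
  theta_OLS D = theta_at A beta 0 (split_data D).
Proof. by rewrite /theta_at /theta_seq big_ord0 mul1mx response_responses. Qed.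

Lemma theta_LuPTS_at (D : 'I_m -> draw R d n) :
  theta_LuPTS D = theta_at A beta n (split_data D).
Proof.
rewrite /theta_LuPTS /theta_at /theta_seq response_responses.
rewrite (design_covariates D ord_max); congr (_ *m _).
apply: eq_bigr => t _.
by rewrite -(design_covariates D (widen_ord (leqnSn n) t)) -(design_covariates D (lift ord0 t)).
Qed.

Lemma measurable_draw_noise : measurable_fun setT draw_noise.
Proof.
have mX t : measurable_fun setT (fun q : draw R d n => tnth q.1 t).
  exact: (measurableT_comp (measurable_tnth t) measurable_fst).
apply/measurable_mxP => i c; under eq_fun do rewrite mxE.
case: (enum_val c) => [[t j]|].
  apply: measurable_mx_entry; apply: measurable_submx => //.
  exact: measurable_mulmx.
apply: measurable_funB; first exact: measurable_snd.
by apply: measurable_sum => j; apply: measurable_funM => //; exact: measurable_mx_entry.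
Qed.

Lemma measurable_split_draw : measurable_fun setT split_draw.
Proof.
apply: measurable_fun_pair; last exact: measurable_draw_noise.
apply: measurable_trmx.
exact: (measurableT_comp (measurable_tnth _) measurable_fst).
Qed.

(** The overwriting maps mirror the nested independence assumptions: rows of the dataset, noise
    vectors within a row, coordinates within a noise vector. *)
Definition put_row (i : 'I_m) (r : 'rV[R]_d * 'rV[R]_N)
    (u : 'M[R]_(m, d) * 'M[R]_(m, N)) :=
  (\matrix_(k, j) (if k == i then r.1 0 j else u.1 k j),
   \matrix_(k, c) (if k == i then r.2 0 c else u.2 k c)).

Lemma measurable_put_row i : measurable_fun setT
  (fun x : ('rV[R]_d * 'rV[R]_N) * ('M[R]_(m, d) * 'M[R]_(m, N)) => put_row i x.1 x.2).
Proof.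
apply: measurable_fun_pair; apply/measurable_mxP => k j;
  under eq_fun do rewrite mxE; case: (k == i); apply: measurable_mx_entry.
- exact: (measurableT_comp measurable_fst measurable_fst).
- exact: (measurableT_comp measurable_fst measurable_snd).
- exact: (measurableT_comp measurable_snd measurable_fst).
- exact: (measurableT_comp measurable_snd measurable_snd).
Qed.

Definition put_block (t : 'I_n) (v : 'cV[R]_d) (r : 'rV[R]_d * 'rV[R]_N) :=
  (r.1, \row_c match enum_val c with
        | Some (t', j) => if t' == t then v j 0 else r.2 0 c
        | None => r.2 0 c
        end).

Lemma measurable_put_block t : measurable_fun setT
  (fun x : 'cV[R]_d * ('rV[R]_d * 'rV[R]_N) => put_block t x.1 x.2).
Proof.
apply: measurable_fun_pair.
  exact: (measurableT_comp measurable_fst measurable_snd).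
have m2 : measurable_fun setT (fun x : 'cV[R]_d * ('rV[R]_d * 'rV[R]_N) => x.2.2).
  exact: (measurableT_comp measurable_snd measurable_snd).
apply/measurable_mxP => i c; under eq_fun do rewrite mxE.
case: (enum_val c) => [[t' j]|]; last exact: measurable_mx_entry.
by case: (t' == t); exact: measurable_mx_entry.
Qed.

Definition put_noise (c : 'I_N) (y : R) (r : 'rV[R]_d * 'rV[R]_N) :=
  (r.1, \row_c' (if c' == c then y else r.2 0 c')).

Lemma measurable_put_noise c : measurable_fun setT
  (fun x : R * ('rV[R]_d * 'rV[R]_N) => put_noise c x.1 x.2).
Proof.
apply: measurable_fun_pair.
  exact: (measurableT_comp measurable_fst measurable_snd).
apply/measurable_mxP => i c'; under eq_fun do rewrite mxE.
case: (c' == c); first exact: measurable_fst.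
apply: measurable_mx_entry.
exact: (measurableT_comp measurable_snd measurable_snd).
Qed.

Definition put_coord (j : 'I_d) (y : R) (v : 'cV[R]_d) : 'cV[R]_d :=
  \col_k (if k == j then y else v k 0).

Lemma measurable_put_coord j :
  measurable_fun setT (fun x : R * 'cV[R]_d => put_coord j x.1 x.2).
Proof.
apply/measurable_mxP => k i; under eq_fun do rewrite mxE.
case: (k == j); first exact: measurable_fst.
by apply: measurable_mx_entry; exact: measurable_snd.
Qed.

Lemma put_block_coord t j y v r :
  put_block t (put_coord j y v) r =
  put_noise (enum_rank (Some (t, j) : noise_index d n)) y (put_block t v r).
Proof.
congr pair; apply/matrixP => i c; rewrite !mxE.
rewrite (_ : (c == _) = (enum_val c == Some (t, j))); last first.
  by rewrite -(inj_eq enum_val_inj) enum_rankK.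
case: (enum_val c) => [[t' j']|] //.
rewrite mxE (_ : (Some (t', j') == Some (t, j)) = (t' == t) && (j' == j)) //.
by case: (t' == t); case: (j' == j).
Qed.

Lemma put_row_noise i c y r u :
  put_row i (put_noise c y r) u =
  ((put_row i r u).1, set_entry i c y (put_row i r u).2).
Proof.
congr pair; apply/matrixP => k l; rewrite !mxE.
by case: (k == i); case: (l == c).
Qed.

End dataset.

(** * Independence and laws of the noise entries of the data *)

Section model.
Variables (R : realType) (m d n : nat).
Variables (A : 'I_n -> 'M[R]_d) (beta : 'cV[R]_d) (sigma : 'I_n -> R) (sigmaY : R).
Context {dO0 : measure_display} {Omega0 : measurableType dO0}.
Variable P0 : probability Omega0 R.
Variables (X : 'I_n.+1 -> {RV P0 >-> 'cV[R]_d}) (Y : {RV P0 >-> R})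
  (eps : 'I_n -> {RV P0 >-> 'cV[R]_d}) (epsY : {RV P0 >-> R}).
Hypothesis HX : forall (t : 'I_n) (w : Omega0),
  X (lift ord0 t) w = (A t)^T *m X (widen_ord (leqnSn n) t) w + eps t w.
Hypothesis HY : forall w : Omega0, Y w = dotv beta (X ord_max w) + epsY w.
Hypothesis Heps : forall t : 'I_n, isotropic_gaussian P0 (sigma t) (eps t).
Hypothesis HepsY : forall B : set R, measurable B ->
  distribution P0 epsY B = gaussian_law 0 sigmaY B.

Let G (k : option (option 'I_n)) : set (set Omega0) :=
  match k with
  | None => g_sigma_algebra_preimage (X ord0)
  | Some (Some t) => g_sigma_algebra_preimage (eps t)
  | Some None => g_sigma_algebra_preimage epsY
  end.

Hypothesis Hindep : mutual_indep P0 G.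
Context {dO : measure_display} {Omega : measurableType dO}.
Variables (P : probability Omega R) (z : 'I_m -> {RV P >-> draw R d n}).
Hypothesis Hiid_law : forall (i : 'I_m) (B : set (draw R d n)), measurable B ->
  distribution P (z i) B =
  pushforward P0 (fun w => ([tuple X t w | t < n.+1], Y w) : draw R d n) B.
Hypothesis Hiid_indep : mutual_indep P
  (fun i : 'I_m => g_sigma_algebra_preimage (z i)).

Local Notation N := #|noise_index d n|.

Definition noise_sd (c : 'I_N) : R :=
  if enum_val c is Some (t, _) then sigma t else sigmaY.

Definition noise_law_row (w : Omega0) : 'rV[R]_d * 'rV[R]_N :=
  ((X ord0 w)^T, \row_c match enum_val c with
                  | Some (t, j) => eps t w j 0
                  | None => epsY w
                  end).

Definition sample (w : Omega) := split_data A beta (fun i => z i w).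

Let draw0 (w : Omega0) : draw R d n := ([tuple X t w | t < n.+1], Y w).

Let split_draw0 w : split_draw A beta (draw0 w) = noise_law_row w.
Proof.
congr pair; first by rewrite tnth_mktuple.
apply/matrixP => i c; rewrite !mxE; case: (enum_val c) => [[t j]|] /=.
  by rewrite !tnth_mktuple HX addrAC subrr add0r.
by rewrite tnth_mktuple HY addrAC subrr add0r.
Qed.

Let measurable_draw0 : measurable_fun setT draw0.
Proof.
apply: measurable_fun_pair => //; apply/measurable_fun_tnthP => t.
by rewrite (_ : _ \o _ = X t)//; apply/funext => w /=; rewrite tnth_mktuple.
Qed.

Let measurable_law_row : measurable_fun setT noise_law_row.
Proof.
rewrite (_ : noise_law_row = split_draw A beta \o draw0); last first.
  by apply/funext => w /=; rewrite split_draw0.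
exact: (measurableT_comp (measurable_split_draw _ _)).
Qed.

Let measurable_split_z i : measurable_fun setT (fun w => split_draw A beta (z i w)).
Proof. exact: (measurableT_comp (measurable_split_draw _ _)). Qed.

Lemma measurable_sample : measurable_fun setT sample.
Proof.
apply: measurable_fun_pair; apply/measurable_mxP => i j;
  under eq_fun do rewrite mxE; apply: measurable_mx_entry.
  have mt : measurable_fun setT (fun q : draw R d n => tnth q.1 ord0).
    exact: (measurableT_comp (measurable_tnth _) measurable_fst).
  exact: (measurableT_comp mt).
exact: (measurableT_comp (measurable_draw_noise _ _)).
Qed.

Let sample_law_row i B : measurable B ->
  P ((fun w => split_draw A beta (z i w)) @^-1` B) = P0 (noise_law_row @^-1` B).
Proof.
move=> mB; have mB' : measurable (split_draw A beta @^-1` B).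
  by rewrite -[X in measurable X]setTI; exact: measurable_split_draw.
rewrite -[LHS]/(distribution P (z i) (split_draw A beta @^-1` B)) Hiid_law//.
by congr (P0 _); apply/seteqP; split => w /=; rewrite split_draw0.
Qed.

Let refresh_row i : refresh P sample P0 noise_law_row (@put_row R m d n i).
Proof.
apply: (@refresh_law R _ _ _ _ _ _ _ _ _ _ P sample P
  (fun w => split_draw A beta (z i w)) P0 noise_law_row (@put_row R m d n i)) => //.
- exact: measurable_put_row.
- exact: sample_law_row.
apply: (@refresh_indep R _ Omega P _ _ i _ _ Hiid_indep _ _ _ _ (z i) sample
  (fun q => put_row i (split_draw A beta q)) (point : draw R d n)) => //.
- by move=> k; apply: sigma_algebra_preimage; exact: sigma_algebra_measurable.
- by move=> k B; apply: sigma_preimage_measurable.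
- have ms : measurable_fun setT
      (fun x : draw R d n * ('M[R]_(m, d) * 'M[R]_(m, N)) =>
         (split_draw A beta x.1, x.2)).
    apply: measurable_fun_pair => //.
    exact: (measurableT_comp (measurable_split_draw _ _)).
  exact: (measurableT_comp (measurable_put_row i) ms).
- exact: measurable_sample.
- by move=> w; congr pair; apply/matrixP => k j; rewrite !mxE;
    case: eqP => // ->; rewrite ?mxE.
- by move=> q q' s; congr pair; apply/matrixP => k j; rewrite !mxE; case: eqP.
apply: others_measurable.
have mo k j : k != i -> measurable_fun
    [set: others_type (fun i : 'I_m => g_sigma_algebra_preimage (z i)) i]
    ((fun w => (tnth (z k w).1 ord0) j 0) : others_type _ i -> R).
  move=> ki; apply: (others_measurable_comp
    (g := fun q : draw R d n => tnth q.1 ord0 j 0) ki) => //.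
  apply: measurable_mx_entry.
  exact: (measurableT_comp (measurable_tnth _) measurable_fst).
have mn k c : k != i -> measurable_fun
    [set: others_type (fun i : 'I_m => g_sigma_algebra_preimage (z i)) i]
    ((fun w => draw_noise A beta (z k w) 0 c) : others_type _ i -> R).
  move=> ki; apply: (others_measurable_comp
    (g := fun q : draw R d n => draw_noise A beta q 0 c) ki) => //.
  by apply: measurable_mx_entry; exact: measurable_draw_noise.
apply: measurable_fun_pair; apply: measurable_matrix_of => k j;
  case: (eqVneq k i) => ki; do ?exact: measurable_cst.
  by apply: others_ext (mo k j ki) => w; rewrite /= mxE.
by apply: others_ext (mn k j ki) => w; rewrite /= [RHS]mxE.
Qed.

Let G_sigma k : sigma_algebra setT (G k).
Proof.
by case: k => [[t|]|]; apply: sigma_algebra_preimage; exact: sigma_algebra_measurable.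
Qed.

Let G_meas k : G k `<=` measurable.
Proof. by case: k => [[t|]|] B; apply: sigma_preimage_measurable. Qed.

Let refresh_block t : refresh P0 noise_law_row P0 (eps t) (@put_block R d n t).
Proof.
apply: (@refresh_indep R _ Omega0 P0 _ G (Some (Some t)) _ _ Hindep _ _ _ _
  (eps t) noise_law_row _ (0 : 'cV[R]_d)) => //.
- exact: measurable_put_block.
- move=> w; congr pair; apply/matrixP => i c; rewrite !mxE.
  by case: (enum_val c) => [[t' j]|] //; case: eqP => // ->.
- move=> v v' r; congr pair; apply/matrixP => i c; rewrite !mxE.
  by case: (enum_val c) => [[t' j]|] //; case: eqP.
apply: others_measurable; apply: measurable_fun_pair.
  apply: (others_measurable_comp (k := None) (f := X ord0) (g := fun v : 'cV[R]_d => v^T)) => //.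
  exact: measurable_trmx.
apply: measurable_matrix_of => i c; case Ec : (enum_val c) => [[t' j]|].
  case: (eqVneq t' t) => [_|tt']; first exact: measurable_cst.
  apply: (others_ext (g := fun w => eps t' w j 0)).
    by move=> w; rewrite /= mxE Ec.
  apply: (others_measurable_comp (k := Some (Some t')) (f := eps t')
    (g := fun v : 'cV[R]_d => v j 0)) => //.
  exact: measurable_mx_entry.
apply: (others_ext (g := fun w => epsY w)); first by move=> w; rewrite /= mxE Ec.
exact: (others_measurable_comp (k := Some None) (f := epsY) (g := id)).
Qed.

Let refresh_coord t j : sigma t != 0 ->
  refresh P0 (eps t) (normal_prob 0 (sigma t)) (id : measurableTypeR R -> R)
    (@put_coord R d j).
Proof.
move=> s0; have [law indep] := Heps t.
apply: (@refresh_law R _ _ _ _ _ _ _ _ _ _ P0 (eps t) P0 (fun w => eps t w j 0)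
  (normal_prob 0 (sigma t)) (id : measurableTypeR R -> R) (@put_coord R d j)).
- exact: measurable_mx_entry.
- exact: measurable_id.
- exact: measurable_put_coord.
- by move=> B mB; have := law j B mB; rewrite /gaussian_law (negPf s0).
apply: (@refresh_indep R _ Omega0 P0 _ _ j _ _ indep _ _ _ _
  (fun w => eps t w j 0) (eps t) _ (0 : R)) => //.
- by move=> k; apply: sigma_algebra_preimage; exact: sigma_algebra_measurable.
- by move=> k B; apply: sigma_preimage_measurable; exact: measurable_mx_entry.
- exact: measurable_put_coord.
- move=> w; apply/matrixP => k i; rewrite !mxE (ord1 i).
  by case: eqP => // ->.
- by move=> v v' r; apply/matrixP => k i; rewrite !mxE; case: eqP.
apply: others_measurable; apply: measurable_matrix_of => k i.
case: (eqVneq k j) => kj; first exact: measurable_cst.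
exact: (others_measurable_comp (k := k) (f := fun w => eps t w k 0) (g := id)).
Qed.

Let refresh_resp : sigmaY != 0 ->
  refresh P0 noise_law_row (normal_prob 0 sigmaY) (id : measurableTypeR R -> R)
    (put_noise (enum_rank (None : noise_index d n))).
Proof.
move=> s0; set c0 := enum_rank _.
apply: (@refresh_law R _ _ _ _ _ _ _ _ _ _ P0 noise_law_row P0 epsY
  (normal_prob 0 sigmaY) (id : measurableTypeR R -> R) (put_noise c0)) => //.
- exact: measurable_put_noise.
- by move=> B mB; have := HepsY mB; rewrite /gaussian_law (negPf s0).
apply: (@refresh_indep R _ Omega0 P0 _ G (Some None) _ _ Hindep _ _ _ _
  epsY noise_law_row _ (0 : R)) => //.
- exact: measurable_put_noise.
- move=> w; congr pair; apply/matrixP => i c; rewrite !mxE.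
  by case: eqP => // ->; rewrite enum_rankK.
- by move=> v v' r; congr pair; apply/matrixP => i c; rewrite !mxE; case: eqP.
apply: others_measurable; apply: measurable_fun_pair.
  apply: (others_measurable_comp (k := None) (f := X ord0) (g := fun v : 'cV[R]_d => v^T)) => //.
  exact: measurable_trmx.
apply: measurable_matrix_of => i c.
case: (eqVneq c c0) => cc0; first exact: measurable_cst.
move: cc0; rewrite -(inj_eq enum_val_inj) enum_rankK.
case Ec : (enum_val c) => [[t' j]|] // _.
apply: (others_ext (g := fun w => eps t' w j 0)).
  by move=> w; rewrite /= mxE Ec.
apply: (others_measurable_comp (k := Some (Some t')) (f := eps t')
  (g := fun v : 'cV[R]_d => v j 0)) => //.
exact: measurable_mx_entry.
Qed.

Let refresh_noise c : noise_sd c != 0 ->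
  refresh P0 noise_law_row (normal_prob 0 (noise_sd c))
    (id : measurableTypeR R -> R) (@put_noise R d n c).
Proof.
rewrite /noise_sd -{3}[c]enum_valK; case: (enum_val c) => [[t j]|]; last first.
  exact: refresh_resp.
move=> s0; apply: (@refresh_lift R _ _ _ _ _ _ _ _ _ _ _ _ P0 noise_law_row P0
  (eps t) (normal_prob 0 (sigma t)) (id : measurableTypeR R -> R)
  (@put_block R d n t) (@put_coord R d j)) => //.
- exact: measurable_put_block.
- exact: measurable_put_noise.
- by move=> y v r; exact: put_block_coord.
- exact: refresh_coord.
Qed.

(** Independence is given separately for the draws, for the noise vectors of one draw and for the
    coordinates of one vector; [refresh_lift] composes these levels down to a single matrix
    entry. *)
Lemma refresh_entry i c : noise_sd c != 0 ->
  refresh P sample (normal_prob 0 (noise_sd c)) (id : measurableTypeR R -> R)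
    (fun y x => (x.1, set_entry i c y x.2)).
Proof.
move=> s0; apply: (@refresh_lift R _ _ _ _ _ _ _ _ _ _ _ _ P sample P0
  noise_law_row (normal_prob 0 (noise_sd c)) (id : measurableTypeR R -> R)
  (@put_row R m d n i) (@put_noise R d n c)) => //.
- exact: measurable_put_row.
- apply: measurable_fun_pair; first exact: (measurableT_comp measurable_fst measurable_snd).
  apply/measurable_mxP => k l; under eq_fun do rewrite mxE.
  case: (_ && _); first exact: measurable_fst.
  apply: measurable_mx_entry.
  exact: (measurableT_comp measurable_snd measurable_snd).
- by move=> y r u; exact: put_row_noise.
- exact: refresh_noise.
Qed.

(** Columns of zero variance have no density and escape the translation argument, but they vanish
    almost surely and are therefore fixed by every rotation. *)
Lemma degenerate_noise i c : noise_sd c = 0 ->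
  {ae P, forall w, (sample w).2 i c = 0}.
Proof.
move=> s0; pose B := [set r : 'rV[R]_d * 'rV[R]_N | r.2 0 c != 0].
have mB : measurable B.
  have mf : measurable_fun setT (fun r : 'rV[R]_d * 'rV[R]_N => r.2 0 c).
    exact: measurable_mx_entry.
  have := mf measurableT _ (measurableC (measurable_set1 (0 : R))).
  rewrite setTI; congr measurable.
  by apply/seteqP; split => r /= /eqP.
exists ((fun w => split_draw A beta (z i w)) @^-1` B); split.
- by rewrite -[X in measurable X]setTI; exact: measurable_split_z.
- rewrite sample_law_row//.
  pose Z : set R := ~` [set 0].
  have m0 : measurable Z by exact: measurableC (measurable_set1 _).
  have dirac0 : @gaussian_law R 0 0 Z = 0%E.
    by rewrite /gaussian_law eqxx diracE memNset//=; apply.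
  move: s0; rewrite /noise_sd; case Ec : (enum_val c) => [[t j]|] s0.
    have [law _] := Heps t; have := law j _ m0; rewrite s0 dirac0 => <-.
    by congr (P0 _); apply/seteqP; split => w;
      rewrite /B /Z /= mxE Ec => /eqP.
  have := HepsY m0; rewrite s0 dirac0 => <-.
  by congr (P0 _); apply/seteqP; split => w;
      rewrite /B /Z /= mxE Ec => /eqP.
- by move=> w; rewrite /B /= => /eqP; rewrite mxE.
Qed.

End model.

(** * The LuPTS estimator *)

Lemma measurable_dotv {R : realType} {dT} {T : measurableType dT} (d : nat)
    (f g : T -> 'cV[R]_d) :
  measurable_fun setT f -> measurable_fun setT g ->
  measurable_fun setT (fun x => dotv (f x) (g x)).
Proof.
move=> mf mg; apply: measurable_sum => j.
by apply: measurable_funM; exact: measurable_mx_entry.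
Qed.

Lemma dotvDl (R : realType) (d : nat) (a b v : 'cV[R]_d) :
  dotv (a + b) v = dotv a v + dotv b v.
Proof. by rewrite /dotv -big_split/=; apply: eq_bigr => j _; rewrite mxE mulrDl. Qed.

Lemma dotvZl (R : realType) (d : nat) k (a v : 'cV[R]_d) :
  dotv (k *: a) v = k * dotv a v.
Proof. by rewrite /dotv mulr_sumr; apply: eq_bigr => j _; rewrite mxE mulrA. Qed.

Lemma dotvBl (R : realType) (d : nat) (a b v : 'cV[R]_d) :
  dotv (a - b) v = dotv a v - dotv b v.
Proof. by rewrite -scaleN1r dotvDl dotvZl mulN1r. Qed.

Lemma dotv_delta (R : realType) (d : nat) (v : 'cV[R]_d) j :
  dotv v (delta_mx j 0) = v j 0.
Proof.
rewrite /dotv (bigD1 j)//= mxE !eqxx mulr1 big1 ?addr0// => k /negPf kj.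
by rewrite mxE kj mulr0.
Qed.

Section lupts.
Context {R : realType} {dO} {O : measurableType dO} (P : probability O R).
Variables (m d n : nat) (A : 'I_n -> 'M[R]_d) (beta : 'cV[R]_d).
Local Notation N := #|noise_index d n|.
Variables (sd : 'I_N -> R) (U : O -> 'M[R]_(m, d)) (E : O -> 'M[R]_(m, N)).
Hypotheses (mU : measurable_fun setT U) (mE : measurable_fun setT E).
Hypothesis fresh : forall i c, sd c != 0 ->
  refresh P (fun w => (U w, E w)) (normal_prob 0 (sd c))
    (id : measurableTypeR R -> R) (fun y x => (x.1, set_entry i c y x.2)).
Hypothesis degenerate : forall i c, sd c = 0 -> {ae P, forall w, E w i c = 0}.

Local Notation S := ('M[R]_(m, d) * 'M[R]_(m, N))%type.

Definition rotate_from (k : nat) (Q : S -> 'M[R]_m) (x : S) : S :=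
  (x.1, \matrix_(i, c)
    if from_step k (enum_val c) then (Q x *m x.2) i c else x.2 i c).

Lemma measurable_rotate_from k Q :
  measurable_fun setT Q -> measurable_fun setT (rotate_from k Q).
Proof.
move=> mQ; apply: measurable_fun_pair; first exact: measurable_fst.
apply: measurable_matrix_of => i c; case: from_step; apply: measurable_mx_entry.
  by apply: measurable_mulmx => //; exact: measurable_snd.
exact: measurable_snd.
Qed.

Lemma rotate_from_law k (Q : S -> 'M[R]_m) :
  measurable_fun setT Q -> (forall x, (Q x)^T *m Q x = 1%:M) ->
  (forall (x : 'M[R]_(m, d)) (e e' : 'M[R]_(m, N)), (forall i c, ~~ from_step k (enum_val c) -> e' i c = e i c) ->
    Q (x, e') = Q (x, e)) ->
  forall h : S -> \bar R, measurable_fun setT h -> (forall s, (0 <= h s)%E) ->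
  (\int[P]_w h (rotate_from k Q (U w, E w)) = \int[P]_w h (U w, E w))%E.
Proof.
move=> mQ QQ Qpast h mh h0.
(* [integral_rotate_columns] covers only columns with a density; on the remaining ones [rotate_from]
   multiplies an almost surely zero column, so the two maps agree almost everywhere. *)
pose F c := from_step k (enum_val c) && (sd c != 0).
have F0 c : F c -> sd c != 0 by case/andP.
have rot := @integral_rotate_columns R _ _ O _ P m N U E mU mE sd F F0
  (fun i c Fc => fresh i (F0 c Fc)) Q h mQ QQ.
rewrite -rot//; last first.
  move=> x e a; apply: Qpast => i c /negPf kc.
  by rewrite mxE mul_maskE /F kc mulr0 addr0.
have mUE : measurable_fun setT (fun w => (U w, E w)) by exact: measurable_fun_pair.
apply: ae_eq_integral => //.
- exact: (measurableT_comp mh (measurableT_comp (measurable_rotate_from k mQ) mUE)).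
- apply: (measurableT_comp mh); apply: measurable_fun_pair => //.
  apply: measurable_addmx => //; apply: measurable_mulmx => //.
  apply: measurable_submx => //; apply: measurable_mulmx => //.
  exact: (measurableT_comp mQ mUE).
have : {ae P, forall w, forall c, sd c = 0 -> forall i, E w i c = 0}.
  apply: filter_forall => c; apply: filter_imply => sc0.
  by apply: filter_forall => i; exact: degenerate.
apply: filterS => w Ew0 _; congr (h (_, _)); apply/matrixP => i c.
rewrite [LHS]mxE [RHS]mxE mul_maskE /F.
case: from_step => /=; last by rewrite mulr0 addr0.
have [sc0|_] /= := eqVneq (sd c) 0; last first.
  set q := Q _ *m _.
  by rewrite mulr1 [(q - E w) i c]mxE [(- E w) i c]mxE addrCA subrr addr0.
rewrite mulr0 addr0 mxE Ew0// big1// => l _.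
by rewrite Ew0// mulr0.
Qed.

Let ols (w : O) := theta_at A beta 0 (U w, E w).
Let lupts (w : O) := theta_at A beta n (U w, E w).
Let theta := (\prod_(t < n) A t) *m beta.

Hypothesis full_rank : forall t, (t <= n)%N -> {ae P, forall w,
  (covariates A (U w) (E w) t)^T *m covariates A (U w) (E w) t \in unitmx}.
Hypothesis ols2 : forall j, L2 P (fun w => ols w j 0).

Let pivot (k : nat) (x : S) : 'M[R]_m := reflector (covariates A x.1 x.2 k).

Let measurable_pivot k : measurable_fun setT (pivot k).
Proof.
apply: measurable_reflector; apply: measurable_covariates.
  exact: measurable_fst.
exact: measurable_snd.
Qed.

Let pivot_past k (x : 'M[R]_(m, d)) (e e' : 'M[R]_(m, N)) :
  (forall i c, ~~ from_step k (enum_val c) -> e' i c = e i c) ->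
  pivot k (x, e') = pivot k (x, e).
Proof. by move=> e'e; rewrite /pivot/= (eq_covariates _ _ e'e). Qed.

Let ols2v v : L2 P (fun w => dotv (ols w) v).
Proof.
apply: (@L2_sum R _ O P _ (index_enum _) (fun j w => ols w j 0 * v j 0)) => j.
by under eq_fun do rewrite mulrC; exact: L2Z.
Qed.

(** Pairing with a fixed vector makes the averaging argument scalar: basis vectors serve the MSE and
    unbiasedness, the test point serves the risk. *)
Lemma lupts_orthogonal v :
  L2 P (fun w => dotv (lupts w) v) /\
  forall psi : 'cV[R]_d -> R, measurable_fun setT psi ->
    L2 P (fun w => psi (lupts w)) ->
    (\int[P]_w (dotv (ols w) v * psi (lupts w))%:E =
     \int[P]_w (dotv (lupts w) v * psi (lupts w))%:E)%E.
Proof.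
(* Step [k] reflects at index [k.+1], the first covariate matrix beyond those used by [theta_at k],
   and rotates only the noise entering after it. *)
pose rot k : S -> S := rotate_from k.+1 (pivot k.+1).
have rotE k x e i c : (rot k (x, e)).2 i c =
    if from_step k.+1 (enum_val c) then (pivot k.+1 (x, e) *m e) i c else e i c.
  by rewrite mxE.
have pfix k x e : pivot k (x, e) *m covariates A x e k = covariates A x e k.
  exact: reflector_fix.
apply: (average_orthogonal (u := fun w => (U w, E w)) (L := theta_at A beta n)
  (th := fun k s => dotv (theta_at A beta k s) v) (tau := rot) (n := n)) => //.
- exact: measurable_fun_pair.
- exact: measurable_theta_at.
- by move=> k; apply: measurable_dotv => //; exact: measurable_theta_at.
- by move=> k; apply: measurable_rotate_from; exact: measurable_pivot.
- move=> k _ h mh h0; apply: rotate_from_law => //.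
  + by move=> x; exact: reflector_orth.
  + exact: pivot_past.
- move=> k kn; apply: filterS (full_rank kn) => w uX.
  rewrite /theta_at (theta_seq_reflect (X' := covariates A (U w) (rot k (U w, E w)).2) _ uX); last first.
    by move=> t tk; apply: (covariates_past _ _ (rotE k _ _)); exact: leqW.
  rewrite -[reflector _]/(pivot k.+1 (U w, E w)).
  rewrite -(responses_rotated beta (rotE k _ _))//.
  by rewrite dotvZl dotvDl.
- move=> k kn; apply: nearW => w; rewrite /theta_at.
  rewrite -[RHS](theta_seq_invariant (k := k.+1)
    (X' := covariates A (U w) (rot k (U w, E w)).2) _ kn
    (reflector_orth (covariates A (U w) (E w) k.+1))).
  + by rewrite -(responses_rotated beta (rotE k _ _)).
  + by move=> t tk; exact: (covariates_past _ _ (rotE k _ _)).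
  + by move=> t /andP[kt _]; exact: (covariates_future (rotE k _ _)).
Qed.

(** Negating all the noise preserves the law and, when the initial design has full rank, turns the
    estimate into [2 theta] minus itself. Its mean is finite, so it can be solved for. *)
Lemma ols_unbiased v : (\int[P]_w (dotv (ols w) v)%:E = (dotv theta v)%:E)%E.
Proof.
have neg_orth : (- 1%:M : 'M[R]_m)^T *m - 1%:M = 1%:M.
  rewrite (_ : (- 1%:M)^T = - 1%:M) ?mulNmx ?mulmxN ?opprK ?mulmx1//.
  by apply/matrixP => i j; rewrite !mxE eq_sym.
have negE (x : S) : rotate_from 0 (fun=> - 1%:M) x = (x.1, - x.2).
  congr pair; apply/matrixP => i c; rewrite mxE (_ : from_step 0 _ = true).
    by rewrite mulNmx mul1mx.
  by case: (enum_val c) => [[]|].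
have mols : measurable_fun setT (fun s : S => dotv (theta_at A beta 0 s) v).
  by apply: measurable_dotv => //; exact: measurable_theta_at.
have olsI := L2_integrable (ols2v v).
have : (\int[P]_w (dotv (theta_at A beta 0 (U w, - E w)) v)%:E =
    \int[P]_w (dotv (ols w) v)%:E)%E.
  rewrite -(integral_invariant (P := P) (u := fun w => (U w, E w))
    (tau := rotate_from 0 (fun=> - 1%:M))
    (f := fun s => (dotv (theta_at A beta 0 s) v)%:E)).
  - by apply: eq_integral => w _; rewrite negE.
  - by apply: rotate_from_law.
  - exact/measurable_EFinP.
have -> : (\int[P]_w (dotv (theta_at A beta 0 (U w, - E w)) v)%:E =
    \int[P]_w ((dotv theta v *+ 2)%:E - (dotv (ols w) v)%:E))%E.
  have mUN : measurable_fun setT (fun w => (U w, - E w)).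
    by apply: measurable_fun_pair => //; exact: measurable_oppmx.
  apply: ae_eq_integral => //.
  - apply/measurable_EFinP; exact: (measurableT_comp mols mUN).
  - apply/measurable_EFinP; apply: measurable_funB => //.
    exact: L2_measurable (ols2v v).
  apply: filterS (full_rank (leq0n n)) => w uX _; rewrite -EFinB; congr (_%:E).
  rewrite /ols /theta_at /theta_seq !big_ord0 !mul1mx/=.
  rewrite (_ : least_squares _ (responses _ _ _ (- _)) =
      theta + theta - least_squares (U w) (responses A beta (U w) (E w))).
    by rewrite dotvBl dotvDl mulr2n.
  apply: (addIr (least_squares (U w) (responses A beta (U w) (E w)))).
  by rewrite subrK -least_squaresD responses_neg mulr2n least_squaresD
    least_squares_id.
rewrite integralB//; last exact: L2_integrable (L2_cst P _).
rewrite integral_cst//= probability_setT mule1.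
have /fineK <- := integrable_fin_num measurableT olsI.
rewrite -EFinB => -[e]; congr (_%:E).
by move: e; rewrite mulr2n; lra.
Qed.

End lupts.

(** * The MSE by coordinates and the risk by test points *)

Section mse.
Local Open Scope ereal_scope.
Context {R : realType} {dO} {O : measurableType dO} (P : probability O R) (d : nat).

Lemma MSE_sum (est : O -> 'cV[R]_d) (theta : 'cV[R]_d) : measurable_fun setT est ->
  MSE P est theta = \sum_(j < d) \int[P]_w ((est w j 0 - theta j 0) ^+ 2)%:E.
Proof.
move=> mest; have mj j : measurable_fun setT (fun w => ((est w j 0 - theta j 0) ^+ 2)%:E).
  apply/measurable_EFinP; apply: measurable_funX; apply: measurable_funB => //.
  exact: measurable_mx_entry.
rewrite /MSE unlock -ge0_integral_sum//; last first.
  by move=> j w _; rewrite lee_fin sqr_ge0.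
apply: eq_integral => w _; rewrite sumEFin; congr (_%:E).
by apply: eq_bigr => j _; rewrite !mxE expr2.
Qed.

(** Once the test draw is outermost, the inner integral is the second moment of a projection of the
    estimator about a constant, to which [pythagoras] applies. *)
Lemma expected_risk_swap {d0} {O0 : measurableType d0} (P0 : probability O0 R)
    (est : O -> 'cV[R]_d) (X : O0 -> 'cV[R]_d) (Y : O0 -> R) :
  measurable_fun setT est -> measurable_fun setT X -> measurable_fun setT Y ->
  expected_risk P est P0 X Y =
  \int[P0]_w0 \int[P]_w ((dotv (est w) (X w0) - Y w0) ^+ 2)%:E.
Proof.
move=> mest mX mY; rewrite /expected_risk unlock.
apply: (ge0_integral_swap P P0
  (f := fun w w0 => ((dotv (est w) (X w0) - Y w0) ^+ 2)%:E)).
  apply/measurable_EFinP; apply: measurable_funX; apply: measurable_funB.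
    apply: measurable_dotv.
      exact: (measurableT_comp mest measurable_fst).
    exact: (measurableT_comp mX measurable_snd).
  exact: (measurableT_comp mY measurable_snd).
by move=> w w0; rewrite lee_fin sqr_ge0.
Qed.

End mse.

Theorem theorem1 (R : realType) (m d n : nat)
    (* parameters; T = n.+1 *)
    (A : 'I_n -> 'M[R]_d) (beta : 'cV[R]_d) (sigma : 'I_n -> R) (sigmaY : R)
    (* the Gaussian-linear system *)
    (dO0 : measure_display) (Omega0 : measurableType dO0)
    (P0 : probability Omega0 R)
    (X : 'I_n.+1 -> {RV P0 >-> 'cV[R]_d}) (Y : {RV P0 >-> R})
    (eps : 'I_n -> {RV P0 >-> 'cV[R]_d}) (epsY : {RV P0 >-> R})
    (HX : forall (t : 'I_n) (w : Omega0),
       X (lift ord0 t) w = (A t)^T *m X (widen_ord (leqnSn n) t) w + eps t w)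
    (HY : forall w : Omega0, Y w = dotv beta (X ord_max w) + epsY w)
    (Heps : forall t : 'I_n, isotropic_gaussian P0 (sigma t) (eps t))
    (HepsY : forall B : set R, measurable B ->
       distribution P0 epsY B = gaussian_law 0 sigmaY B)
    (Hindep : mutual_indep P0 (fun k : option (option 'I_n) =>
       match k with
       | None => g_sigma_algebra_preimage (X ord0)
       | Some (Some t) => g_sigma_algebra_preimage (eps t)
       | Some None => g_sigma_algebra_preimage epsY
       end))
    (* the data: m i.i.d. copies of (X_1, ..., X_T, Y) *)
    (dO : measure_display) (Omega : measurableType dO)
    (P : probability Omega R)
    (z : 'I_m -> {RV P >-> draw R d n})
    (Hiid_law : forall (i : 'I_m) (B : set (draw R d n)), measurable B ->
       distribution P (z i) B =
       pushforward P0
         (fun w => ([tuple X t w | t < n.+1], Y w) : draw R d n) B)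
    (Hiid_indep : mutual_indep P
       (fun i : 'I_m => g_sigma_algebra_preimage (z i))) :
  let D := fun (w : Omega) (i : 'I_m) => z i w in
  let OLS := fun w => theta_OLS (D w) in
  let LuPTS := fun w => theta_LuPTS (D w) in
  let theta := (\prod_(t < n) A t) *m beta in
  (forall t : 'I_n.+1,
     {ae P, forall w, (design (D w) t)^T *m design (D w) t \in unitmx}) ->
  (MSE P OLS theta < +oo)%E ->
  (expected_risk P OLS P0 (X ord0) Y < +oo)%E ->
  [/\ forall j : 'I_d, ('E_P[fun w => LuPTS w j ord0] = (theta j ord0)%:E)%E,
      (MSE P LuPTS theta =
         MSE P OLS theta - 'E_P[cond_var_vec P LuPTS OLS])%E,
      (expected_risk P LuPTS P0 (X ord0) Y =
         expected_risk P OLS P0 (X ord0) Y -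
         \int[P0]_w0 'E_P[cond_var P LuPTS
                            (fun w => dotv (OLS w) (X ord0 w0))])%E,
      (MSE P LuPTS theta <= MSE P OLS theta)%E &
      (expected_risk P LuPTS P0 (X ord0) Y <=
         expected_risk P OLS P0 (X ord0) Y)%E].
Proof.
move=> D OLS LuPTS theta full mse_fin risk_fin.
pose U w := design (D w) ord0; pose E w := data_noise A beta (D w).
have mUE : measurable_fun setT (fun w => (U w, E w)) by exact: measurable_sample.
have mU : measurable_fun setT U by exact: (measurableT_comp measurable_fst mUE).
have mE : measurable_fun setT E by exact: (measurableT_comp measurable_snd mUE).
have fresh i c : noise_sd sigma sigmaY c != 0 ->
    refresh P (fun w => (U w, E w)) (normal_prob 0 (noise_sd sigma sigmaY c))
      (id : measurableTypeR R -> R) (fun y x => (x.1, set_entry i c y x.2)).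
  exact: (refresh_entry HX HY Heps HepsY Hindep Hiid_law Hiid_indep).
have degen i c : noise_sd sigma sigmaY c = 0 -> {ae P, forall w, E w i c = 0}.
  exact: (degenerate_noise HX HY Heps HepsY Hiid_law).
have full_rank t : (t <= n)%N -> {ae P, forall w,
    (covariates A (U w) (E w) t)^T *m covariates A (U w) (E w) t \in unitmx}.
  move=> tn; have tn1 : (t < n.+1)%N by [].
  apply: filterS (full (Ordinal tn1)) => w.
  by rewrite -(design_covariates A beta (D w) (Ordinal tn1)).
have olsF : OLS = fun w => theta_at A beta 0 (U w, E w).
  by apply/funext => w; exact: theta_OLS_at.
have luptsF : LuPTS = fun w => theta_at A beta n (U w, E w).
  by apply/funext => w; exact: theta_LuPTS_at.
have mOLS : measurable_fun setT OLS.
  by rewrite olsF; exact: (measurableT_comp (measurable_theta_at _ _ _) mUE).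
have mL : measurable_fun setT LuPTS.
  by rewrite luptsF; exact: (measurableT_comp (measurable_theta_at _ _ _) mUE).
have ols2 j : L2 P (fun w => OLS w j 0).
  have mj : measurable_fun setT (fun w => OLS w j 0) by exact: measurable_mx_entry.
  (* A finite MSE bounds each coordinate of the deviation from [theta]; adding a constant keeps
     square integrability. *)
  have dev2 : L2 P (fun w => OLS w j 0 - theta j 0).
    apply: L2P; first exact: measurable_funB.
    apply: le_lt_trans mse_fin; rewrite MSE_sum// (bigD1 j)//= leeDl// sume_ge0// => k _.
    by apply: integral_ge0 => w _; rewrite lee_fin sqr_ge0.
  have := L2D dev2 (L2_cst P (theta j 0)).
  by under eq_fun do rewrite subrK.
have orth v : L2 P (fun w => dotv (LuPTS w) v) /\
  forall psi : 'cV[R]_d -> R, measurable_fun setT psi ->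
    L2 P (fun w => psi (LuPTS w)) ->
    (\int[P]_w (dotv (OLS w) v * psi (LuPTS w))%:E =
     \int[P]_w (dotv (LuPTS w) v * psi (LuPTS w))%:E)%E.
  rewrite luptsF olsF; apply: (lupts_orthogonal mU mE fresh degen full_rank) => j.
  by have := ols2 j; rewrite olsF.
have ols2v v : L2 P (fun w => dotv (OLS w) v).
  apply: (@L2_sum R _ _ P _ (index_enum _) (fun j w => OLS w j 0 * v j 0)) => j.
  by under eq_fun do rewrite mulrC; exact: L2Z.
have mdot v : measurable_fun setT (fun t : 'cV[R]_d => dotv t v).
  exact: measurable_dotv.
have pyth v c := pythagoras (mdot v) (fun w => erefl) (ols2v v) (orth v).1 (orth v).2 c.
have cvar v := integral_cond_var mL (mdot v) (fun w => erefl) (ols2v v) (orth v).1 (orth v).2.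
have diff2 v := L2B (ols2v v) (orth v).1.
have unbiased : forall j : 'I_d, ('E_P[fun w => LuPTS w j ord0] = (theta j ord0)%:E)%E.
  move=> j; rewrite unlock; pose v : 'cV[R]_d := delta_mx j 0.
  (* The constant test function equates the means of LuPTS and OLS. *)
  have := (orth v).2 (cst 1) (measurable_cst _) (L2_cst P 1).
  under eq_integral do rewrite mulr1.
  under [RHS]eq_integral do rewrite mulr1 dotv_delta.
  move=> <-; rewrite -[theta j _]dotv_delta olsF.
  apply: (ols_unbiased mU mE fresh degen full_rank) => k.
  by have := ols2 k; rewrite olsF.
have cvar_ge0 v : (0 <= \int[P]_w (cond_var P LuPTS (fun w => dotv (OLS w) v) w)%:E)%E.
  by rewrite cvar; apply: integral_ge0 => w _; rewrite lee_fin sqr_ge0.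
have entryF (f : Omega -> 'cV[R]_d) j :
    (fun w => f w j 0) = (fun w => dotv (f w) (delta_mx j 0)).
  by apply/funext => w; rewrite dotv_delta.
have cvec : ('E_P[cond_var_vec P LuPTS OLS] =
    \sum_(j < d) \int[P]_w ((OLS w j 0 - LuPTS w j 0) ^+ 2)%:E)%E.
  rewrite unlock; under eq_integral do rewrite -sumEFin.
  rewrite integral_sum//.
    apply: eq_bigr => j _; rewrite entryF cvar.
    by apply: eq_integral => w _; rewrite !dotv_delta.
  move=> j; rewrite entryF.
  by have [] := cond_var_is_cond_exp mL (mdot (delta_mx j 0)) (fun w => erefl)
    (ols2v _) (orth _).1 (orth _).2.
have mseE : (MSE P OLS theta = MSE P LuPTS theta + 'E_P[cond_var_vec P LuPTS OLS])%E.
  rewrite !MSE_sum// cvec -big_split/=; apply: eq_bigr => j _.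
  have := pyth (delta_mx j 0) (theta j 0).
  under eq_integral do rewrite dotv_delta.
  under [X in (_ = X + _)%E -> _]eq_integral do rewrite dotv_delta.
  by under [X in (_ = _ + X)%E -> _]eq_integral do rewrite !dotv_delta.
(* Versions of the conditional variance are chosen separately for each test point. Their integral
   over the data equals [gap], whose measurability in the test point follows from Tonelli. *)
pose gap w0 := (\int[P]_w ((dotv (OLS w) (X ord0 w0) - dotv (LuPTS w) (X ord0 w0)) ^+ 2)%:E)%E.
have mdotX (f : Omega -> 'cV[R]_d) : measurable_fun setT f ->
    measurable_fun setT (fun x : Omega0 * Omega => dotv (f x.2) (X ord0 x.1)).
  move=> mf; apply: measurable_dotv; first exact: (measurableT_comp mf measurable_snd).
  exact: (measurableT_comp _ measurable_fst).
have mgap : measurable_fun setT gap.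
  apply: (measurable_ge0_integral P (f := fun w0 w =>
    ((dotv (OLS w) (X ord0 w0) - dotv (LuPTS w) (X ord0 w0)) ^+ 2)%:E)).
    apply/measurable_EFinP; apply: measurable_funX.
    by apply: measurable_funB; exact: mdotX.
  by move=> w0 w; rewrite lee_fin sqr_ge0.
have gap_ge0 w0 : (0 <= gap w0)%E.
  by apply: integral_ge0 => w _; rewrite lee_fin sqr_ge0.
have gapE : (\int[P0]_w0 'E_P[cond_var P LuPTS (fun w => dotv (OLS w) (X ord0 w0))] =
    \int[P0]_w0 gap w0)%E.
  by apply: eq_integral => w0 _; rewrite unlock cvar.
have riskE : (expected_risk P OLS P0 (X ord0) Y =
    expected_risk P LuPTS P0 (X ord0) Y + \int[P0]_w0 gap w0)%E.
  rewrite !expected_risk_swap// -ge0_integralD//.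
  - by apply: eq_integral => w0 _; exact: pyth.
  - by move=> w0 _; apply: integral_ge0 => w _; rewrite lee_fin sqr_ge0.
  - apply: (measurable_ge0_integral P (f := fun w0 w =>
      ((dotv (LuPTS w) (X ord0 w0) - Y w0) ^+ 2)%:E)).
      apply/measurable_EFinP; apply: measurable_funX.
      apply: measurable_funB; first exact: mdotX.
      exact: (measurableT_comp _ measurable_fst).
    by move=> w0 w; rewrite lee_fin sqr_ge0.
have gapI_ge0 : (0 <= \int[P0]_w0 gap w0)%E by exact: integral_ge0.
have cvec_ge0 : (0 <= 'E_P[cond_var_vec P LuPTS OLS])%E.
  rewrite cvec; apply: sume_ge0 => j _.
  by apply: integral_ge0 => w _; rewrite lee_fin sqr_ge0.
have mseL_ge0 : (0 <= MSE P LuPTS theta)%E.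
  rewrite MSE_sum//; apply: sume_ge0 => j _.
  by apply: integral_ge0 => w _; rewrite lee_fin sqr_ge0.
have riskL_ge0 : (0 <= expected_risk P LuPTS P0 (X ord0) Y)%E.
  rewrite expected_risk_swap//; apply: integral_ge0 => w0 _.
  by apply: integral_ge0 => w _; rewrite lee_fin sqr_ge0.
(* In the extended reals a sum can be turned into a difference only when the subtracted term is
   finite; here it is bounded by the finite OLS quantity. *)
have addK (a b c : \bar R) : (c = a + b -> 0 <= a -> 0 <= b -> c < +oo ->
    a = c - b /\ a <= c)%E.
  move=> -> a0 b0 ab; split; last exact: leeDl.
  by rewrite addeK// ge0_fin_numE// (le_lt_trans _ ab)// leeDr.
have [mse1 mse2] := addK _ _ _ mseE mseL_ge0 cvec_ge0 mse_fin.
have [risk1 risk2] := addK _ _ _ riskE riskL_ge0 gapI_ge0 risk_fin.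
by split => //; rewrite gapE.
Qed.
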